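(* Let $1\le p\le\infty$. Let $F:\mathbb{T}\to\mathbb{C}$ be such that $t\mapsto F(e^{it})$ is absolutely continuous on $[0,2\pi]$ (with $F(e^{i0})=F(e^{i2\pi})$), and suppose $\dot F\in L^p(0,2\pi)$, where $\dot F(e^{it})=\frac{d}{dt}F(e^{it})$. Suppose $w=P[F]$ is a quasiregular mapping of $\mathbb{D}$ with outer dilatation $K\ge1$. Then $w_z\in H^p$, $\overline{w_{\bar z}}\in H^p$, and $$\|w_z\|_p\le K\|\dot F\|_{L^p},\qquad \|\overline{w_{\bar z}}\|_p\le\frac{K-1}{2}\|\dot F\|_{L^p}.$$
   Context: $\mathbb{D}$ is the open unit disk and $\mathbb{T}$ the unit circle. For $F\in L^1(\mathbb{T})$, $P[F](re^{i\theta})=\int_0^{2\pi}P_r(t-\theta)F(e^{it})\,dt$ with $P_r(t-\theta)=\frac{1}{2\pi}\frac{1-r^2}{1-2r\cos(t-\theta)+r^2}$. $w_z=\frac12(w_x-iw_y)$, $w_{\bar z}=\frac12(w_x+iw_y)$; for harmonic $w$, both $w_z$ and $\overline{w_{\bar z}}$ are analytic in $\mathbb{D}$. A harmonic mapping $w$ of $\mathbb{D}$ is quasiregular if there is a constant $K\ge1$ with $(|w_z|+|w_{\bar z}|)^2\le K(|w_z|^2-|w_{\bar z}|^2)$ in $\mathbb{D}$; the smallest such $K$ is the outer dilatation. For $G$ on $[0,2\pi]$, $\|G\|_{L^p}=\left(\frac{1}{2\pi}\int_0^{2\pi}|G(e^{it})|^p\,dt\right)^{1/p}$ for $p<\infty$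 and $\|G\|_{L^\infty}=\operatorname{ess\,sup}|G|$. For analytic $f$ on $\mathbb{D}$, $M_p(r,f)=\left(\frac1{2\pi}\int_0^{2\pi}|f(re^{i\theta})|^p d\theta\right)^{1/p}$ ($0<p<\infty$), $M_\infty(r,f)=\max_\theta|f(re^{i\theta})|$; $f\in H^p$ if $M_p(r,f)$ is bounded in $r\in(0,1)$, and $\|f\|_p=\lim_{r\to1^-}M_p(r,f)$. *)

(* Defs.v *)
From HB Require Import structures.
From mathcomp Require Import all_boot all_order all_algebra.
From mathcomp Require Import all_classical all_reals all_analysis.
From mathcomp Require Import complex.
Import ComplexField.
Import Order.TTheory GRing.Theory Num.Theory.
Import numFieldNormedType.Exports.

Set Implicit Arguments.
Unset Strict Implicit.
Unset Printing Implicit Defensive.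

Local Open Scope classical_set_scope.
Local Open Scope ring_scope.
Local Open Scope complex_scope.

Section Defs.
Variable R : realType.

Definition cRe (z : R[i]) : R := complex.Re z.
Definition cIm (z : R[i]) : R := complex.Im z.

Definition cmod (z : R[i]) : R := Num.sqrt (cRe z ^+ 2 + cIm z ^+ 2).

Definition polar (r theta : R) : R[i] := (r * cos theta) +i* (r * sin theta).

Definition I2pi : set R := `[0%R, (2 * pi)%R].

Definition expi (t : R) : R[i] := polar 1 t.

Definition abs_continuous (a b : R) (g : R -> R[i]) : Prop :=
  forall e : R, 0 < e -> exists2 d : R, 0 < d &
    forall (n : nat) (s t : nat -> R),
      (forall k, (k < n)%N -> a <= s k /\ s k <= t k /\ t k <= b) ->
      (forall k l, (k < n)%N -> (l < n)%N -> k <> l -> t k <= s l \/ t l <= s k) ->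
      \sum_(k < n) (t k - s k) < d ->
      \sum_(k < n) cmod (g (t k) - g (s k)) < e.

Definition Fdot (F : R[i] -> R[i]) (t : R) : R[i] :=
  (derive1 (fun s => cRe (F (expi s))) t) +i* (derive1 (fun s => cIm (F (expi s))) t).

Definition Lp_norm (p : \bar R) (G : R -> R) : \bar R :=
  match p with
  | q%:E => (((2 * pi)^-1)%:E *
             \int[lebesgue_measure]_(t in I2pi) ((`|G t| `^ q)%:E)) `^ q^-1
  | +oo%E => ereal_inf [set y : \bar R |
               \forall t \ae lebesgue_measure, t \in I2pi -> ((`|G t|)%:E <= y)%E]
  | -oo%E => 0%E
  end.

Definition poisson_kernel (r x : R) : R :=
  (2 * pi)^-1 * ((1 - r ^+ 2) / (1 - 2 * r * cos x + r ^+ 2)).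

Definition poisson_integral (F : R[i] -> R[i]) (r theta : R) : R[i] :=
  (\int[lebesgue_measure]_(t in I2pi) (poisson_kernel r (t - theta) * cRe (F (expi t))))%R
  +i* (\int[lebesgue_measure]_(t in I2pi) (poisson_kernel r (t - theta) * cIm (F (expi t))))%R.

Definition wx (w : R[i] -> R[i]) (z : R[i]) : R[i] :=
  (derive1 (fun s => cRe (w (s +i* cIm z))) (cRe z))
  +i* (derive1 (fun s => cIm (w (s +i* cIm z))) (cRe z)).
Definition wy (w : R[i] -> R[i]) (z : R[i]) : R[i] :=
  (derive1 (fun s => cRe (w (cRe z +i* s))) (cIm z))
  +i* (derive1 (fun s => cIm (w (cRe z +i* s))) (cIm z)).

Definition wz (w : R[i] -> R[i]) (z : R[i]) : R[i] := (wx w z - 'i * wy w z) / 2.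
Definition wzbar (w : R[i] -> R[i]) (z : R[i]) : R[i] := (wx w z + 'i * wy w z) / 2.

Definition qr_ineq (w : R[i] -> R[i]) (K : R) : Prop :=
  forall z, cmod z < 1 ->
    (cmod (wz w z) + cmod (wzbar w z)) ^+ 2
      <= K * (cmod (wz w z) ^+ 2 - cmod (wzbar w z) ^+ 2).

Definition outer_dilatation (w : R[i] -> R[i]) (K : R) : Prop :=
  [/\ 1 <= K, qr_ineq w K & forall K', 1 <= K' -> qr_ineq w K' -> K <= K'].

Definition Mp (p : \bar R) (f : R[i] -> R[i]) (r : R) : \bar R :=
  match p with
  | q%:E => (((2 * pi)^-1)%:E *
             \int[lebesgue_measure]_(th in I2pi) ((cmod (f (polar r th)) `^ q)%:E)) `^ q^-1
  | +oo%E => ereal_sup [set (cmod (f (polar r th)))%:E | th in I2pi]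
  | -oo%E => 0%E
  end.

Definition analytic_disk (f : R[i] -> R[i]) : Prop :=
  forall z : R[i], cmod z < 1 -> derivable (f : R[i]^o -> R[i]^o) z 1.

Definition hardy (p : \bar R) (f : R[i] -> R[i]) : Prop :=
  analytic_disk f /\ exists M : R, forall r : R, 0 < r < 1 -> (Mp p f r <= M%:E)%E.

Definition hardy_norm (p : \bar R) (f : R[i] -> R[i]) : \bar R :=
  lim (Mp p f r @[r --> 1^'-]).

End Defs.

(* Main.v *)
(** On the circle [|z| = r] the gradient of [w] is controlled by the angular
    derivative [w_theta = i (z w_z - conj z w_zbar)]: quasiregularity turns
    [r (|w_z| - |w_zbar|) <= |w_theta|] into [r |w_z| <= K |w_theta|] and
    [r |w_zbar| <= (K - 1) / 2 |w_theta|]. Integrating by parts, [w_theta] is the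
    Poisson integral of [Fdot], so Jensen's inequality and Tonelli's theorem bound
    its integral means by the norm of [Fdot]; let [r] tend to 1. Writing [2 pi]
    times the Poisson kernel as [u + conj u - 1] with [u = 1 / (1 - z e^(-it))]
    exhibits [w_z] and [conj w_zbar] as Cauchy type integrals, which are analytic.

    Integration by parts rests on the fundamental theorem of calculus for an
    absolutely continuous [f]: its total variation [V] is absolutely continuous, so
    the Lebesgue-Stieltjes measures of [V] and [V - f] vanish on null sets; the
    difference of their Radon-Nikodym derivatives is a density of [f], equal to
    [f'] almost everywhere by the Lebesgue differentiation theorem. *)

Require Import Defs.
From HB Require Import structures.
From mathcomp Require Import all_boot all_order all_algebra.
From mathcomp Require Import all_classical all_reals all_analysis.
From mathcomp Require Import complex measurable_realfun ring lra.
Import ComplexField.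
Import Order.TTheory GRing.Theory Num.Theory.
Import numFieldNormedType.Exports.

Local Open Scope classical_set_scope.
Local Open Scope ring_scope.
Local Open Scope complex_scope.

(** * Absolutely continuous functions *)

Section absolute_continuity.
Variable R : realType.
Implicit Types (a b x y e d : R) (f g : R -> R) (s u : seq (R * R)) (l : seq R).

(** Nothing is differentiated under the integral sign. The kernels are rational in [z], so their
    Taylor remainders are exact expressions with a factor [h ^+ 2], bounded uniformly in [t];
    integrating these identities yields both the partial derivatives of [w] and the complex
    differentiability of [w_z] and [conj w_zbar]. Origin of the constants: with A = |w_z| and B =
    |w_zbar|, dividing the dilatation inequality by A + B gives A + B <= K (A - B), that is 2 B <=
    (K - 1) (A - B); then A = (A - B) + B <= (K + 1) / 2 (A - B) <= K (A - B). The factor r in r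
    |w_z| leaves means bounded by a multiple of 1 / r. This is harmless as r tends to 1 but not near
    0, so membership in the Hardy space needs a separate bound on small radii, read off from the
    Cauchy type integrals. *)

Definition nonoverlapping (p q : R * R) : bool := (p.2 <= q.1) || (q.2 <= p.1).

Definition subsegment a b (p : R * R) : bool := [&& a <= p.1, p.1 <= p.2 & p.2 <= b].

Definition itv_family a b s : bool := all (subsegment a b) s && pairwise nonoverlapping s.

(** Families are lists, so that subdividing a segment is a concatenation. The final inequality is
    not strict, so that it survives the supremum that defines the total variation. *)
Definition real_ac a b f : Prop := forall e, 0 < e -> exists2 d, 0 < d &
  forall s, itv_family a b s -> \sum_(p <- s) (p.2 - p.1) < d ->
    \sum_(p <- s) `|f p.2 - f p.1| <= e.

Lemma real_acB a b f g : real_ac a b f -> real_ac a b g -> real_ac a b (f \- g).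
Proof.
move=> fac gac e e0; have e20 : 0 < e / 2 by rewrite divr_gt0.
have [d1 d10 h1] := fac _ e20; have [d2 d20 h2] := gac _ e20.
exists (Num.min d1 d2) => [|s fs]; first by rewrite lt_min d10.
rewrite lt_min => /andP[/(h1 _ fs) s1 /(h2 _ fs) s2].
rewrite (splitr e); apply: le_trans (lerD s1 s2); rewrite -big_split/=.
apply: ler_sum => p _; apply: le_trans (ler_normB _ _).
by rewrite le_eqVlt; apply/orP; left; apply/eqP; congr `|_|; ring.
Qed.

Lemma real_ac_unif a b f : real_ac a b f -> forall e, 0 < e -> exists2 d, 0 < d &
  forall x y, a <= x <= b -> a <= y <= b -> `|x - y| < d -> `|f x - f y| <= e.
Proof.
move=> fac e /fac[d d0 h]; exists d => // x y.
wlog yx : x y / y <= x.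
  move=> hw xab yab; have [yx|/ltW xy] := leP y x; first exact: hw.
  by rewrite distrC (distrC (f x)); exact: hw.
move=> /andP[ax xb] /andP[ay yb]; rewrite ger0_norm ?subr_ge0// => xyd.
have := h [:: (y, x)]; rewrite /itv_family/= /subsegment/= ay yx xb/= !big_seq1/=.
exact.
Qed.

(** The segments between consecutive points, zipped in the order of [variation_zip], so that a
    variation is a sum over these pieces by [big_map]. *)
Definition itv_pieces x l : seq (R * R) := [seq (q.2, q.1) | q <- zip l (x :: l)].

Lemma itv_partition_pieces x y l : itv_partition x y l ->
  itv_family x y (itv_pieces x l) /\ \sum_(p <- itv_pieces x l) (p.2 - p.1) = y - x.
Proof.
rewrite /itv_pieces; elim: l x => [x /itv_partition_nil ->|z l ih x xyl].
  by rewrite /= big_nil subrr.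
have /ih[/andP[fam1 fam2] fams] := itv_partition_cons xyl.
have xz : x <= z by case: xyl => /= /andP[/ltW].
have zy : z <= y by apply: itv_partition_le (itv_partition_cons xyl).
split; last by rewrite /= big_cons fams/=; ring.
rewrite /itv_family/= {1}/subsegment/= lexx xz zy/= fam2 andbT; apply/andP; split.
  by apply: sub_all fam1 => p /and3P[zp pp py]; rewrite /subsegment (le_trans xz)// pp.
by apply: sub_all fam1 => p /and3P[zp pp py]; rewrite /nonoverlapping/= zp.
Qed.

Lemma itv_family_refine a b u s x y l : itv_family a b (u ++ (x, y) :: s) ->
  itv_partition x y l -> itv_family a b ((u ++ itv_pieces x l) ++ s).
Proof.
move=> /andP[]; rewrite all_cat pairwise_cat/= allrel_consr.
move=> /and3P[allu /and3P[/= ax _ yb] alls] /and4P[/andP[ua us] pu ys ps].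
move=> /itv_partition_pieces[/andP[pa pp] _].
apply/andP; split; rewrite -catA !(all_cat,pairwise_cat) ?allu ?alls ?andbT//=.
  by apply: sub_all pa => p /and3P[? ? ?]; rewrite /subsegment (le_trans ax)//= (le_trans _ yb)// andbT.
rewrite pu ps pp/= allrel_catr us !andbT; apply/andP; split.
  apply/allrelP => q p qu /(allP pa)/and3P[xp _ py].
  have /= := allP ua q qu; rewrite /nonoverlapping/= => /orP[h|h].
    by rewrite (le_trans h).
  by rewrite (le_trans py h) orbT.
apply/allrelP => q p /(allP pa)/and3P[xp _ py] ps'.
have /= := allP ys p ps'; rewrite /nonoverlapping/= => /orP[h|h].
  by rewrite (le_trans py).
by rewrite (le_trans h xp) orbT.
Qed.

(* The total variations are approximated one interval at a time; [u] collects
   the pieces already subdivided. *)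
Lemma sum_total_variation_le a b f e d :
  (forall s, itv_family a b s -> \sum_(p <- s) (p.2 - p.1) < d ->
    \sum_(p <- s) `|f p.2 - f p.1| <= e) ->
  forall s u, itv_family a b (u ++ s) -> \sum_(p <- u ++ s) (p.2 - p.1) < d ->
  ((\sum_(p <- u) `|f p.2 - f p.1|)%:E +
     \sum_(p <- s) total_variation p.1 p.2 f <= e%:E)%E.
Proof.
move=> h; elim => [u|[x y] s ih u us ud].
  by rewrite cats0 big_nil adde0 lee_fin; exact: h.
have xy : x <= y by case/andP : us; rewrite all_cat => /and3P[_ /and3P[]].
have sge0 : (0 <= \sum_(p <- s) total_variation p.1 p.2 f)%E.
  rewrite big_seq sume_ge0// => p ps; apply: total_variation_ge0.
  by case/andP : us; rewrite all_cat/= => /and3P[_ _ /allP/(_ p ps)/and3P[]].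
have key l : itv_partition x y l ->
    ((\sum_(p <- u) `|f p.2 - f p.1|)%:E + ((variation x y f l)%:E +
     \sum_(p <- s) total_variation p.1 p.2 f) <= e%:E)%E.
  move=> xyl; have [_ sl] := itv_partition_pieces _ _ _ xyl.
  have := ih (u ++ itv_pieces x l) (itv_family_refine _ _ _ _ _ _ _ us xyl).
  move: ud; rewrite !big_cat/= sl big_cons/= addrA => /[swap] /[apply].
  by rewrite EFinD -addeA (variation_zip _ xyl) big_map.
have [l0 xyl0] : exists l, itv_partition x y l.
  move: xy; rewrite le_eqVlt => /predU1P[->|xy]; last first.
    by exists [:: y]; exact: itv_partition1.
  by exists [::]; split => //=.
(* Once the tail is known to be finite it can be moved to the right-hand side, which leaves a
   supremum over the partitions of the head segment alone. *)
have sfin : (\sum_(p <- s) total_variation p.1 p.2 f)%E \is a fin_num.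
  rewrite ge0_fin_numE//; apply: le_lt_trans (ltry e); apply: le_trans (key _ xyl0).
  by rewrite addeA leeDr// -EFinD lee_fin addr_ge0 ?variation_ge0// sumr_ge0.
rewrite big_cons/= addeA -leeBrDr// addeC -leeBrDr//.
apply: ge_ereal_sup => _ [_ [l xyl <-] <-].
by rewrite leeBrDr// leeBrDr// (addeC (variation x y f l)%:E) -addeA key.
Qed.

(** For [e = 1], a segment shorter than [d] has variation at most 1. Steps of length [d / 2],
    strictly below [d], cover [[a, b]] in finitely many moves, and the variation is additive. *)
Lemma real_ac_bounded_variation a b f : a <= b -> real_ac a b f -> bounded_variation a b f.
Proof.
move=> ab /(_ 1 ltr01)[d d0 h].
have small x y : a <= x -> x <= y -> y <= b -> y - x < d -> (total_variation x y f <= 1)%E.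
  move=> ax xy yb xyd; have := sum_total_variation_le _ _ _ _ _ h [:: (x, y)] [::].
  rewrite /= !big_seq1 /= big_nil add0e; apply => //.
  by rewrite /itv_family/= /subsegment/= ax xy yb.
have hn (n : nat) y : a <= y <= b -> y - a <= n%:R * (d / 2) -> (total_variation a y f <= n%:R%:E)%E.
  elim: n y => [|n ih] y /andP[ay yb].
    rewrite mul0r subr_le0 => ya; have -> : y = a by apply/eqP; rewrite eq_le ya.
    by rewrite total_variationxx.
  move=> yn; pose z := Num.max a (y - d / 2).
  have az : a <= z by rewrite le_max lexx.
  have zy : z <= y by rewrite ge_max ay/= gerBl divr_ge0// ltW.
  rewrite (total_variationD _ az zy) -natr1 EFinD leeD//.
    apply: ih; first by rewrite az (le_trans zy).
    rewrite lerBlDr ge_max lerDr mulr_ge0 ?divr_ge0 ?(ltW d0)//=.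
    by move: yn; rewrite -natr1 mulrDl mul1r; lra.
  apply: small => //.
  have : y - d / 2 <= z by rewrite le_max lexx orbT.
  by lra.
apply/(bounded_variationP _ ab).
rewrite ge0_fin_numE ?total_variation_ge0//.
pose n := Num.bound ((b - a) / (d / 2)).
have /le_lt_trans : (total_variation a b f <= n%:R%:E)%E.
  apply: hn; rewrite ?ab ?lexx// -ler_pdivrMr ?divr_gt0//.
  by apply/ltW/archi_boundP; rewrite divr_ge0 ?divr_ge0 ?subr_ge0// ltW.
by apply; rewrite ltry.
Qed.

Section variation_function.
Variables (a b : R) (f : R -> R).
Hypotheses (ab : a <= b) (fac : real_ac a b f).

Let V x := fine (total_variation a x f).

Let VB x y : a <= x -> x <= y -> y <= b ->
  (V y - V x)%:E = total_variation x y f.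
Proof.
move=> ax xy yb; have bv := real_ac_bounded_variation _ _ _ ab fac.
have bx : total_variation a x f \is a fin_num.
  by apply/(bounded_variationP _ ax)/(bounded_variationl ax (le_trans xy yb) bv).
have by_ : total_variation a y f \is a fin_num.
  by apply/(bounded_variationP _ (le_trans ax xy))/(bounded_variationl (le_trans ax xy) yb bv).
by rewrite EFinB !fineK// (total_variationD _ ax xy) addeAC subee ?add0e.
Qed.

(** The [d] that serves [f] also serves [V]: subdividing the segments of a family keeps it
    nonoverlapping and of the same total length. *)
Lemma real_ac_variation : real_ac a b V.
Proof.
move=> e /fac[d d0 h]; exists d => // s fs sd.
have := sum_total_variation_le _ _ _ _ _ h s [::] fs sd.
rewrite big_nil add0e -lee_fin; apply: le_trans.
rewrite -sumEFin big_seq [leRHS]big_seq; apply: lee_sum => p ps.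
have /and3P[ap pp pb] : subsegment a b p by case/andP : fs => /allP/(_ p ps).
rewrite -VB// lee_fin ger0_norm// -lee_fin VB//.
exact: total_variation_ge0.
Qed.

Lemma variation_homo x y : a <= x -> x <= y -> y <= b -> V x <= V y.
Proof.
by move=> ax xy yb; rewrite -subr_ge0 -lee_fin VB// total_variation_ge0.
Qed.

(** With [variation_homo], this is the Jordan decomposition f = V - (V - f) into monotone functions,
    both absolutely continuous. *)
Lemma variationB_homo x y : a <= x -> x <= y -> y <= b -> V x - f x <= V y - f y.
Proof.
move=> ax xy yb.
have : `|f y - f x| <= V y - V x by rewrite -lee_fin VB// total_variation_ge.
have := ler_norm (f y - f x); lra.
Qed.

End variation_function.

End absolute_continuity.

(** * Densities of absolutely continuous functions *)

Section ac_density.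
Variable R : realType.
Implicit Types (a b x y e d : R) (f g : R -> R).
Local Notation mu := (@lebesgue_measure R).

(** Applied to the components of an open set of small measure: an unbounded interval would contain a
    half-line, of infinite measure. *)
Lemma open_interval_itvoo (I : set R) : open I -> is_interval I ->
  (mu I < +oo)%E -> I = set0 \/ exists2 p : R * R, p.1 < p.2 & I = `]p.1, p.2[%classic.
Proof.
move=> oI iI Ifin; have [->|/set0P[x Ix]] := eqVneq I set0; [by left|right].
have mI : measurable I by exact: open_measurable.
have ubI : has_ubound I.
  apply: contrapT => nub.
  suff : `[x, +oo[%classic `<=` I.
    move=> sub; have h : (mu `[x, +oo[%classic <= mu I)%E by rewrite le_measure ?inE//; exact: measurable_itv.
    by move: Ifin; rewrite ltNge => /negP; apply; rewrite (le_trans _ h)// lebesgue_measure_itv/= ltry.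
  move=> y /=; rewrite in_itv/= andbT => xy.
  have [z Iz yz] : exists2 z, I z & y < z.
    apply: contrapT => h; apply: nub; exists y => z Iz; rewrite leNgt; apply/negP => yz.
    by apply: h; exists z.
  by apply: (iI x z) => //; rewrite xy ltW.
have lbI : has_lbound I.
  apply: contrapT => nlb.
  suff : `]-oo, x]%classic `<=` I.
    move=> sub; have h : (mu `]-oo, x]%classic <= mu I)%E by rewrite le_measure ?inE//; exact: measurable_itv.
    by move: Ifin; rewrite ltNge => /negP; apply; rewrite (le_trans _ h)// lebesgue_measure_itv/= ltNyr.
  move=> y /=; rewrite in_itv/= => xy.
  have [z Iz yz] : exists2 z, I z & z < y.
    apply: contrapT => h; apply: nlb; exists y => z Iz; rewrite leNgt; apply/negP => yz.
    by apply: h; exists z.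
  by apply: (iI z x) => //; rewrite xy ltW.
have IE := interval_bounded_interior iI lbI ubI.
have {}IE : I = `]inf I, sup I[%classic by rewrite -IE; apply/esym/interior_id.
exists (inf I, sup I) => //=.
by move: Ix; rewrite {1}IE/= in_itv/= => /andP[]; exact: lt_trans.
Qed.

(** The projection of the line onto [[a, b]]. A Stieltjes measure needs a monotone, right-continuous
    function on the whole line, and composing with this 1-Lipschitz monotone map provides one with
    no mass outside [[a, b]]. *)
Definition clamp_itv a b x : R := Num.max a (Num.min x b).

Section monotone.
Variables (a b : R) (g : R -> R).
Hypotheses (ab : a <= b) (gac : real_ac R a b g).
Hypothesis (gnd : forall x y, a <= x -> x <= y -> y <= b -> g x <= g y).

Local Notation clamp := (clamp_itv a b).

Let clampP x : a <= clamp x <= b.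
Proof. by rewrite /clamp_itv le_max lexx ge_max ab ge_min lexx orbT. Qed.

Let clamp_id x : a <= x <= b -> clamp x = x.
Proof. by rewrite /clamp_itv => /andP[ax xb]; rewrite min_l// max_r. Qed.

Let clamp_homo x y : x <= y -> clamp x <= clamp y.
Proof. by move=> xy; rewrite /clamp_itv ge_max !le_max lexx/= le_min !ge_min xy lexx !orbT. Qed.

Let clamp_lip x y : x <= y -> clamp y - clamp x <= y - x.
Proof.
rewrite /clamp_itv => xy; have abs := ab.
case: (leP x b) => xb; case: (leP y b) => yb; last by rewrite subrr subr_ge0.
- by case: (leP a x) => ax; case: (leP a y) => ay; lra.
- by case: (leP a x) => ax; case: (leP a b) => ay; lra.
- by lra.
Qed.

Let G x := g (clamp x).

Lemma real_ac_clamp_continuous : continuous (fun x => g (clamp x)).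
Proof.
move=> x; apply/cvgrPdist_le => e e0; have [d d0 h] := real_ac_unif _ _ _ _ gac _ e0.
near=> y; apply: h => //; apply: le_lt_trans (_ : `|x - y| < d); last first.
  by near: y; exact: cvgr_dist_lt.
have [xy|/ltW yx] := leP x y.
  by rewrite distrC (distrC x) !ger0_norm ?subr_ge0 ?clamp_homo// clamp_lip.
by rewrite !ger0_norm ?subr_ge0 ?clamp_homo// clamp_lip.
Unshelve. all: by end_near. Qed.

Let G_nd : nondecreasing_fun G.
Proof.
by move=> x y xy; apply: gnd; rewrite ?clamp_homo//; [case/andP: (clampP x)|case/andP: (clampP y)].
Qed.

Let Gc : cumulative R R :=
  HB.pack G (isCumulative.Build R _ R G G_nd (right_continuousW real_ac_clamp_continuous)).

Let nu := lebesgue_stieltjes_measure Gc.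

Let nu_oc x y : x <= y -> nu `]x, y]%classic = (G y - G x)%:E.
Proof.
move=> xy; rewrite /nu /lebesgue_stieltjes_measure /measure_extension.
by rewrite measurable_mu_extE/=; [rewrite wlength_itv_bnd|exact: is_ocitv].
Qed.

(** Outer regularity encloses [A] in an open set of length below [d]. The clamped components of that
    set form families as in [real_ac], so any finitely many of them have total [nu]-mass at most
    [e], and the bound passes to the series. *)
Let nu_null (A : set R) : measurable A -> mu A = 0%E -> nu A = 0%E.
Proof.
move=> mA A0; apply/eqP; rewrite -measure_le0; apply/lee_addgt0Pr => e e0; rewrite add0e.
have [d d0 h] := gac _ e0.
have Afin : (mu A < +oo)%E by rewrite A0 ltry.
have [U [oU AU UA]] := lebesgue_regularity_outer mA Afin d0.
have mU : measurable U by exact: open_measurable.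
have Ud : (mu U < d%:E)%E.
  have h2 : (mu ((U `\` A) `|` A) <= mu (U `\` A) + mu A)%E.
    by apply: measureU2 => //; exact: measurableD.
  by apply: le_lt_trans UA; move: h2; rewrite A0 adde0 setUC setDUK.
pose J := open_disjoint_itv oU.
have mI k : measurable (J k) by apply: open_measurable; exact: open_disjoint_itv_open.
have UI : U = \bigcup_k J k .
  by exact: open_disjoint_itv_bigcup.
have tI : trivIset setT J by exact: open_disjoint_itv_trivIset.
have muU : mu U = (\sum_(0 <= k <oo) mu (J k))%E.
  by rewrite UI; apply: measure_semi_bigcup => //; rewrite -UI.
have {}mI0 n : (\sum_(k < n) mu (J k) < d%:E)%E.
  apply: le_lt_trans Ud; rewrite muU -(big_mkord xpredT (fun k => mu (J k))).
  exact: nneseries_lim_ge.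
(* An empty component is encoded as [(a, a)]: once clamped, it overlaps no segment of [[a, b]], so
   it can stay in the family. *)
have I_oo k : exists p : R * R, p.1 <= p.2 /\ J k = `]p.1, p.2[%classic /\ (p.1 = p.2 -> p = (a, a)).
  have Jfin : (mu (J k) < +oo)%E.
    apply: le_lt_trans (ltry d); apply: le_trans (ltW Ud).
    apply: (le_measure mu (mem_set (mI k)) (mem_set mU)).
    by move=> z Jz; rewrite UI; exists k.
  have [||I0|[p p12 Ip]] := open_interval_itvoo (J k) _ _ Jfin.
  - by exact: open_disjoint_itv_open.
  - by exact: open_disjoint_itv_is_interval.
  - by exists (a, a); rewrite /= I0 set_itvoo0.
  - by exists p; rewrite (ltW p12); split => //; split => // pE; move: p12; rewrite pE ltxx.
have /choice[P HP] := I_oo.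
have IP k : J k = `](P k).1, (P k).2[%classic by case: (HP k) => _ [].
have P12 k : (P k).1 <= (P k).2 by case: (HP k).
have mu_I k : mu (J k) = ((P k).2 - (P k).1)%:E.
  rewrite IP lebesgue_measure_itv/= lte_fin.
  have := P12 k; rewrite le_eqVlt => /predU1P[->|->]; last by rewrite EFinB.
  by rewrite ltxx subrr.
have nu_I k : (nu (J k) <= (g (clamp (P k).2) - g (clamp (P k).1))%:E)%E.
  rewrite -nu_oc//; apply: (le_measure nu (mem_set (mI k)) (mem_set (measurable_itv _))).
  by rewrite IP; apply: subset_itvl; rewrite bnd_simp.
have sumI n : (\sum_(k < n) nu (J k) <= e%:E)%E.
  pose s := [seq (clamp (P k).1, clamp (P k).2) | k <- iota 0 n].
  have fs : itv_family R a b s.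
    apply/andP; split.
      apply/allP => _ /mapP[k _ ->]; rewrite /subsegment/= clamp_homo//.
      by case/andP: (clampP (P k).1) => ->; case/andP: (clampP (P k).2).
    rewrite pairwise_map; apply: (@sub_pairwise _ ltn); last first.
      by rewrite -(sorted_pairwise ltn_trans) iota_ltn_sorted.
    move=> j k jk; rewrite /nonoverlapping/=.
    have aa : clamp a = a by rewrite clamp_id// lexx ab.
    have := P12 j; rewrite le_eqVlt => /predU1P[/((HP j).2.2) ->/=|pj].
      by rewrite aa; case/andP: (clampP (P k).1) => ->.
    have := P12 k; rewrite le_eqVlt => /predU1P[/((HP k).2.2) ->/=|pk].
      by rewrite aa orbC; case/andP: (clampP (P j).1) => ->.
    have [/clamp_homo->//|kj] := leP (P j).2 (P k).1.
    have [/clamp_homo->|jk'] := leP (P k).2 (P j).1; first by rewrite orbT.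
    exfalso; have /trivIsetP/(_ j k I I) := tI.
    rewrite (ltn_eqF jk) => /(_ isT); rewrite -/J !IP => /seteqP[+ _].
    (* If neither interval ends before the other begins, this midpoint lies in both, against the
       disjointness of the components. *)
    pose z := (Num.max (P j).1 (P k).1 + Num.min (P j).2 (P k).2) / 2.
    have mm : Num.max (P j).1 (P k).1 < Num.min (P j).2 (P k).2.
      by rewrite gt_max !lt_min pj pk kj jk'.
    have [z1 z2] := midf_lt mm.
    move=> /(_ z); apply; rewrite /= !in_itv/=.
    move: z1 z2; rewrite -/z gt_max !lt_min => /andP[-> ->] /andP[-> ->].
    by [].
  have := h s fs; rewrite !big_map.
  rewrite (_ : \sum_(j <- iota 0 n) _ = \sum_(k < n) (clamp (P k).2 - clamp (P k).1)); last first.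
    by rewrite -(big_mkord xpredT (fun k => clamp (P k).2 - clamp (P k).1)) /index_iota subn0.
  rewrite (_ : \sum_(j <- iota 0 n) _ = \sum_(k < n) `|g (clamp (P k).2) - g (clamp (P k).1)|); last first.
    by rewrite -(big_mkord xpredT (fun k => `|g (clamp (P k).2) - g (clamp (P k).1)|)) /index_iota subn0.
  move=> hs; apply: (@le_trans _ _ (\sum_(k < n) `|g (clamp (P k).2) - g (clamp (P k).1)|)%:E).
    rewrite -sumEFin; apply: lee_sum => k _; apply: le_trans (nu_I k) _.
    by rewrite lee_fin ler_norm.
  rewrite lee_fin; apply: hs; rewrite -lte_fin; apply: le_lt_trans (mI0 n).
  rewrite -sumEFin; apply: lee_sum => k _.
  by rewrite mu_I lee_fin clamp_lip.
have mI' k : measurable (J k) by exact: mI.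
apply: le_trans (_ : (nu U <= e%:E)%E); first exact: (le_measure nu (mem_set mA) (mem_set mU) AU).
have -> : nu U = (\sum_(0 <= k <oo) nu (J k))%E.
  by rewrite UI; apply: measure_semi_bigcup => //; rewrite -UI.
apply: lime_le; first by apply: is_cvg_nneseries.
by apply: nearW => n; rewrite big_mkord.
Qed.

(** The Radon-Nikodym theorem applies to [nu] restricted to []a, b]], of finite mass by [nu_oc].
    Intersecting [[a, x]] with this half-open interval leaves []a, x]], whose mass is the increment
    [g x - g a]. *)
Lemma monotone_ac_density : exists2 h : R -> R,
  mu.-integrable setT (EFin \o h) &
  forall x, a <= x <= b -> g x - g a = (\int[mu]_(t in `[a, x]) h t)%R.
Proof.
have mD : measurable (`]a, b]%classic : set (measurableTypeR R)) by exact: measurable_itv.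
have Dfin : (nu `]a, b]%classic < +oo)%E by rewrite nu_oc// ltry.
pose nuD := charge_of_finite_measure (mfrestr mD Dfin).
have dom : nuD `<< mu.
  apply/null_content_dominatesP => A mA A0.
  rewrite /nuD /charge_of_finite_measure /mfrestr /mrestr.
  have mAD : measurable (A `&` `]a, b]%classic) by exact: measurableI.
  by apply: nu_null => //; apply: (subset_measure0 mAD mA _ A0) => z [].
pose H := Radon_Nikodym nuD mu.
have HE : H = EFin \o (fine \o H).
  by apply/funext => x /=; rewrite fineK// Radon_Nikodym_fin_num.
exists (fine \o H); first by rewrite -HE; exact: Radon_Nikodym_integrable.
move=> x axb; have /andP[ax xb] := axb.
rewrite /Rintegral -[X in fine X]/(\int[mu]_(t in `[a, x]) (EFin \o (fine \o H)) t)%E -HE.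
have mx : measurable (`[a, x]%classic : set (measurableTypeR R)) by exact: measurable_itv.
rewrite -(Radon_Nikodym_integral dom mx).
transitivity (fine (nu `]a, x]%classic)).
  by rewrite nu_oc//= /G !clamp_id ?lexx ?ab// ax xb.
congr fine; rewrite -[RHS]/(nu (`[a, x]%classic `&` `]a, b]%classic)); congr (nu _).
apply/seteqP; split => z /=; rewrite !in_itv/=.
  by move=> /andP[az zx]; rewrite az zx (ltW az) (le_trans zx).
by move=> [/andP[_ ->] /andP[->]].
Qed.

End monotone.

Lemma real_ac_density a b f : a <= b -> real_ac R a b f -> exists2 h : R -> R,
  mu.-integrable setT (EFin \o h) &
  forall x, a <= x <= b -> f x - f a = (\int[mu]_(t in `[a, x]) h t)%R.
Proof.
move=> ab fac.
have Vac := real_ac_variation _ _ _ _ ab fac.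
have Vfac := real_acB _ _ _ _ _ Vac fac.
have [h1 ih1 h1E] := monotone_ac_density _ _ _ ab Vac (variation_homo _ _ _ _ ab fac).
have [h2 ih2 h2E] := monotone_ac_density _ _ _ ab Vfac (variationB_homo _ _ _ _ ab fac).
have ih : mu.-integrable setT (EFin \o (h1 \- h2)).
  by rewrite (_ : _ \o _ = (EFin \o h1) \- (EFin \o h2))%E//; exact: integrableB.
exists (h1 \- h2) => // x axb; rewrite RintegralB//.
- by rewrite -h1E// -h2E//=; ring.
- by apply: integrableS ih1.
- by apply: integrableS ih2.
Qed.

End ac_density.

(** * Bounded measurable functions on a segment *)

Section bounded_measurable.
Context {R : realType}.
Variables (a b : R).
Implicit Types f g h : R -> R.
Local Notation mu := (@lebesgue_measure R).
Local Notation D := (`[a, b]%classic : set R).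

(** Unlike integrability, this is stable under products, and on a segment it implies integrability;
    so the integrability of every product of a kernel with boundary data follows from closure
    lemmas. *)
Definition bounded_measurable f : Prop :=
  measurable_fun D f /\ exists M, forall x, D x -> `|f x| <= M.

Lemma bounded_measurable_cst (c : R) : bounded_measurable (fun=> c).
Proof. by split; [exact: measurable_cst|exists `|c|]. Qed.

Lemma bounded_measurableD f g : bounded_measurable f -> bounded_measurable g ->
  bounded_measurable (fun x => f x + g x).
Proof.
move=> [mf [M fM]] [mg [N gN]]; split; first exact: measurable_funD.
by exists (M + N) => x Dx; apply: le_trans (ler_normD _ _) _; rewrite lerD ?fM ?gN.
Qed.

Lemma bounded_measurableN f : bounded_measurable f -> bounded_measurable (fun x => - f x).
Proof.
move=> [mf [M fM]]; split; first exact: measurableT_comp.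
by exists M => x Dx; rewrite normrN fM.
Qed.

Lemma bounded_measurableB f g : bounded_measurable f -> bounded_measurable g ->
  bounded_measurable (fun x => f x - g x).
Proof. by move=> bf bg; apply: bounded_measurableD => //; exact: bounded_measurableN. Qed.

Lemma bounded_measurableM f g : bounded_measurable f -> bounded_measurable g ->
  bounded_measurable (fun x => f x * g x).
Proof.
move=> [mf [M fM]] [mg [N gN]]; split; first exact: measurable_funM.
by exists (M * N) => x Dx; rewrite normrM ler_pM ?fM ?gN.
Qed.

Lemma continuous_bounded_measurable f : continuous f -> bounded_measurable f.
Proof.
move=> cf; split; first by apply: measurable_funTS; exact: continuous_measurable_fun.
have [ab|ba] := leP a b; last first.
  by exists 0 => x; rewrite /= in_itv/= => /andP[ax xb]; move: (le_trans ax xb); rewrite leNgt ba.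
have [c _ cM] := EVT_max ab (continuous_subspaceT (fun x => cvg_norm (cf x)) : {within D, continuous (Num.norm \o f)}).
by exists `|f c| => x Dx; exact: cM.
Qed.

Lemma bounded_measurable_integrableM f g : bounded_measurable f ->
  mu.-integrable D (EFin \o g) -> mu.-integrable D (EFin \o (fun x => f x * g x)).
Proof.
move=> [mf [M fM]] ig.
have -> : EFin \o (fun x => f x * g x) = ((EFin \o f) \* (EFin \o g))%E.
  by apply/funext => x /=; rewrite EFinM.
apply: integrableMr => //; exists M; split; rewrite ?num_real// => y My x Dx.
exact: le_trans (fM _ Dx) (ltW My).
Qed.

Lemma bounded_measurable_integrable f : bounded_measurable f -> mu.-integrable D (EFin \o f).
Proof.
have Dfin : (mu D < +oo)%E.
  by rewrite lebesgue_measure_itv/=; case: ifP => // _; rewrite ltry.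
move=> [mf [M fM]]; apply: measurable_bounded_integrable => //.
by exists M; split; rewrite ?num_real// => y My x Dx; exact: le_trans (fM _ Dx) (ltW My).
Qed.

End bounded_measurable.

(** * Integration by parts for absolutely continuous functions *)

Section ac_by_parts.
Variable R : realType.
Implicit Types (a b x y e d : R) (f g phi : R -> R).
Local Notation mu := (@lebesgue_measure R).

(** Nothing is known of [f] outside [[a, b]], but on it [f] agrees with its composite with the
    clamp, which is continuous on the line. *)
Lemma real_ac_bounded_measurable a b f : a <= b -> real_ac R a b f ->
  bounded_measurable a b f.
Proof.
move=> ab fac; have cf := real_ac_clamp_continuous _ _ _ _ ab fac.
have [mf [M fM]] := continuous_bounded_measurable a b _ cf.
have clampE x : x \in `[a, b] -> clamp_itv R a b x = x.
  by rewrite in_itv /clamp_itv/= => /andP[ax xb]; rewrite min_l// max_r.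
split; last by exists M => x Dx; rewrite -(clampE x)//; exact: fM.
by apply: eq_measurable_fun mf => x /[!inE] Dx; rewrite clampE.
Qed.

(** An increment of the product is at most N times that of [f] plus L M times the length. The [+ 1]
    in [N + 1] and [L * M + 1] keeps the divisors positive. *)
Lemma real_acM_lipschitz a b f phi (M N L : R) : a <= b -> 0 <= L ->
  (forall x, a <= x <= b -> `|f x| <= M) -> (forall x, a <= x <= b -> `|phi x| <= N) ->
  (forall x y, a <= x -> x <= y -> y <= b -> `|phi y - phi x| <= L * (y - x)) ->
  real_ac R a b f -> real_ac R a b (fun x => phi x * f x).
Proof.
move=> ab L0 fM phiN phiL fac e e0.
have M0 : 0 <= M by apply: le_trans (fM a _); rewrite ?lexx.
have N0 : 0 <= N by apply: le_trans (phiN a _); rewrite ?lexx.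
have N1 : 0 < N + 1 by rewrite ltr_wpDl.
have LM1 : 0 < L * M + 1 by rewrite ltr_wpDl// mulr_ge0.
have [d d0 h] := fac _ (divr_gt0 (divr_gt0 e0 (ltr0Sn _ 1)) N1).
exists (Num.min d (e / 2 / (L * M + 1))) => [|s fs].
  by rewrite lt_min d0/= !divr_gt0.
rewrite lt_min => /andP[sd se].
have {}h := h s fs sd.
apply: (@le_trans _ _ (\sum_(p <- s) (N * `|f p.2 - f p.1| + (L * M) * (p.2 - p.1)))).
  rewrite big_seq [leRHS]big_seq; apply: ler_sum => p ps.
  have /and3P[ap pp pb] : subsegment R a b p by case/andP : fs => /allP/(_ p ps).
  rewrite (_ : _ - _ = phi p.2 * (f p.2 - f p.1) + (phi p.2 - phi p.1) * f p.1); last by ring.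
  apply: le_trans (ler_normD _ _) _; rewrite !normrM; apply: lerD.
    by rewrite ler_wpM2r// phiN// pb (le_trans ap pp).
  by rewrite mulrAC ler_pM// ?phiL// fM// ap (le_trans pp pb).
rewrite big_split/= -!mulr_sumr (splitr e); apply: lerD.
  apply: le_trans (_ : (N + 1) * (e / 2 / (N + 1)) <= _).
    by apply: ler_pM => //; [exact: sumr_ge0|rewrite lerDl].
  by rewrite mulrC divfK ?gt_eqF.
apply: le_trans (_ : (L * M + 1) * (e / 2 / (L * M + 1)) <= _); last first.
  by rewrite mulrC divfK ?gt_eqF.
apply: ler_pM; rewrite ?mulr_ge0// ?lerDl//; last exact: ltW.
rewrite big_seq sumr_ge0// => p ps; rewrite subr_ge0.
by case/andP : fs => /allP/(_ p ps)/and3P[].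
Qed.

Lemma derivable_is_derive1 (f : R -> R) (x : R) :
  derivable f x 1 -> is_derive x 1 f (derive1 f x).
Proof. by move=> df; apply: DeriveDef => //; rewrite derive1E. Qed.

Lemma near_derive1_add (G f : R -> R) (c x : R) : (\forall y \near x, G y + c = f y) ->
  derivable G x 1 -> derivable f x 1 /\ derive1 f x = derive1 G x.
Proof.
move=> E /derivable_is_derive1 dG.
have dGc := @is_deriveD _ _ _ G (cst c) x 1 _ _ dG (is_derive_cst c x 1).
have [df e] := @near_eq_is_derive _ _ _ (G + cst c) f x 1 _ E dGc.
by split=> //; rewrite derive1E e addr0.
Qed.

Lemma derive1_mul (f phi : R -> R) (x d : R) : is_derive x 1 phi d -> derivable f x 1 ->
  derive1 (fun y => phi y * f y) x = d * f x + phi x * derive1 f x.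
Proof.
move=> dphi /derivable_is_derive1 df.
have [_ e] := @is_deriveM _ _ phi f x 1 _ _ dphi df.
by rewrite derive1E e /GRing.scale/= addrC (mulrC (f x)).
Qed.

(** [derive1] is two-sided, hence the open interval: around an interior point [f] equals the
    primitive of [h] up to a constant, and [FTC1] differentiates that primitive almost
    everywhere. *)
Lemma density_derivable a b f (h : R -> R) : mu.-integrable setT (EFin \o h) ->
  (forall x, a <= x <= b -> f x - f a = (\int[mu]_(t in `[a, x]) h t)%R) ->
  {ae mu, forall x, `]a, b[%classic x -> derivable f x 1 /\ derive1 f x = h x}.
Proof.
move=> ih fh.
have ihy y : mu.-integrable [set` Interval (BLeft a) (BRight y)] (EFin \o h).
  by apply: integrableS ih.
have loch : locally_integrable [set: R] h 
  by apply: open_integrable_locally => //; exact: openT.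
have := FTC1 ihy loch; apply: (@filterS _ _ (ae_filter_ringOfSetsType mu)) => x + /=.
rewrite in_itv/= => dx /andP[ax xb].
have {dx} [dF <-] := dx (ax : (a%:E < x%:E)%E).
have E : \forall y \near x, (\int[mu]_(t in `[a, y]) h t)%R + f a = f y.
  near=> y; rewrite -fh ?subrK//; apply/andP; split; apply: ltW.
    by near: y; exact: lt_nbhsr.
  by near: y; exact: lt_nbhsl.
exact: near_derive1_add E dF.
Unshelve. all: by end_near. Qed.

(* Integration by parts reduces to the fundamental theorem for the product,
   which is again absolutely continuous. *)
Lemma real_ac_integration_by_parts a b f phi (phi' : R -> R) : a < b ->
  real_ac R a b f -> measurable_fun `[a, b] (derive1 f) ->
  (forall x, is_derive x 1 phi (phi' x)) -> continuous phi' ->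
  mu.-integrable `[a, b] (EFin \o (derive1 f)) /\
  (\int[mu]_(x in `[a, b]) (phi' x * f x))%R + (\int[mu]_(x in `[a, b]) (phi x * derive1 f x))%R
    = phi b * f b - phi a * f a.
Proof.
move=> ab fac mf' dphi cphi'; have leab := ltW ab.
have cphi : continuous phi by move=> x; apply/differentiable_continuous/derivable1_diffP.
have bf := real_ac_bounded_measurable _ _ _ leab fac.
have bphi := continuous_bounded_measurable a b _ cphi.
have bphi' := continuous_bounded_measurable a b _ cphi'.
have [_ [M fM]] := bf; have [_ [N phiN]] := bphi; have [_ [L phi'L]] := bphi'.
have pfac : real_ac R a b (fun x => phi x * f x).
  apply: (@real_acM_lipschitz a b f phi M N L) => //.
  - by apply: le_trans (phi'L a _); rewrite //= in_itv/= lexx.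
  - move=> x y ax xy yb.
    (* By the mean value theorem, a bound [L] of the continuous [phi'] is a Lipschitz constant of
       [phi]. *)
    have [c cxy ->] := MVT_segment xy (fun z _ => dphi z) (continuous_subspaceT cphi).
    rewrite normrM (ger0_norm (_ : 0 <= y - x)) ?subr_ge0// ler_wpM2r ?subr_ge0//.
    apply: phi'L; move: cxy; rewrite /= !in_itv/= => /andP[xc cy].
    by rewrite (le_trans ax xc) (le_trans cy yb).
have [h ih hE] := real_ac_density _ _ _ _ leab fac.
have [k ik kE] := real_ac_density _ _ _ _ leab pfac.
have ihab : mu.-integrable `[a, b] (EFin \o h) by exact: integrableS ih.
have nab : {ae mu, forall x, x != a /\ x != b}.
  exists [set a; b]; split; first exact: measurableU.
    by apply: countable_lebesgue_measure0; exact: finite_set_countable.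
  by move=> x /= /not_andP[] /negP/negPn/eqP; [left|right].
have endpoints (P : R -> Prop) : {ae mu, forall x, `]a, b[%classic x -> P x} ->
    {ae mu, forall x, `[a, b]%classic x -> P x}.
  apply: (@filterS2 _ _ (ae_filter_ringOfSetsType mu) _ _ _ _ nab) => x [xa xb] Px; rewrite /= in_itv/= => /andP[ax bx].
  by apply: Px; rewrite /= in_itv/= !lt_neqAle eq_sym xa ax xb bx.
have fh := endpoints _ (density_derivable _ _ _ _ ih hE).
have pk := endpoints _ (density_derivable _ _ _ _ ik kE).
(* Integrability of the derivative is inherited from the density [h], to which it is equal almost
   everywhere. *)
have if' : mu.-integrable `[a, b] (EFin \o (derive1 f)).
  have mf'E : measurable_fun `[a, b] (EFin \o derive1 f) by exact/measurable_EFinP.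
  apply/integrableP; split=> //; have /integrableP[mh] := ihab; congr (_ < +oo)%E.
  apply: ae_eq_integral => //; [exact: measurableT_comp|exact: measurableT_comp|].
  by apply: (@filterS _ _ (ae_filter_ringOfSetsType mu) _ _ _ fh) => x fx xab /=; rewrite (fx xab).2.
split => //.
have i1 : mu.-integrable `[a, b] (EFin \o (fun x => phi' x * f x)).
  by apply: bounded_measurable_integrable; exact: bounded_measurableM.
have i2 : mu.-integrable `[a, b] (EFin \o (fun x => phi x * derive1 f x)).
  exact: bounded_measurable_integrableM.
rewrite -RintegralD// kE ?lexx ?leab//; congr fine; apply: ae_eq_integral => //.
- by apply/measurable_EFinP; apply: measurable_funD; apply/measurable_EFinP; [exact: measurable_int i1|exact: measurable_int i2].
- by apply: measurable_int; exact: integrableS ik.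
- apply: (@filterS2 _ _ (ae_filter_ringOfSetsType mu) _ _ _ _ fh pk) => x fx px xab; have [dfx _] := fx xab; have [_ <-] := px xab.
  by congr EFin; rewrite (derive1_mul _ _ _ _ (dphi x) dfx).
Qed.

End ac_by_parts.

(** * Complex-valued integrals and the Cauchy kernel *)

Section cmod_theory.
Variable R : realType.
Implicit Types (x y z h : R[i]) (r s t : R).

Lemma cmodE z : (cmod z)%:C = `|z|.
Proof. by rewrite normc_def. Qed.

Lemma ltc_cmod z (r : R) : (cmod z < r) = (`|z| < r%:C).
Proof. by rewrite -cmodE ltcR. Qed.

Lemma cmod_ge0 z : 0 <= cmod z.
Proof. exact: sqrtr_ge0. Qed.

Lemma cmodM x y : cmod (x * y) = cmod x * cmod y.
Proof.
by apply/(@complexI R); rewrite cmodE normrM -!cmodE rmorphM.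
Qed.

Lemma cmodX x (n : nat) : cmod (x ^+ n) = cmod x ^+ n.
Proof. by apply/(@complexI R); rewrite cmodE normrX -!cmodE rmorphXn. Qed.

Lemma cmodV x : cmod x^-1 = (cmod x)^-1.
Proof. by apply/(@complexI R); rewrite cmodE normfV -!cmodE fmorphV. Qed.

Lemma cmodJ x : cmod x^* = cmod x.
Proof. by apply/(@complexI R); rewrite !cmodE normcJ. Qed.

Lemma cmodN x : cmod (- x) = cmod x.
Proof. by apply/(@complexI R); rewrite !cmodE normrN. Qed.

Lemma cmod_real r : cmod r%:C = `|r|.
Proof. by rewrite /cmod /cRe /cIm/= expr0n/= addr0 sqrtr_sqr. Qed.

Lemma cmod_i : cmod ('i : R[i]) = 1.
Proof. by rewrite /cmod /cRe /cIm/= expr0n/= add0r expr1n sqrtr1. Qed.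

Lemma cmodD x y : cmod (x + y) <= cmod x + cmod y.
Proof. by rewrite -lecR rmorphD/= !cmodE ler_normD. Qed.

Lemma cmodB x y : cmod x - cmod y <= cmod (x - y).
Proof. by rewrite -lecR rmorphB/= !cmodE lerB_dist. Qed.

Lemma cmod_sqr z : cmod z ^+ 2 = cRe z ^+ 2 + cIm z ^+ 2.
Proof. by rewrite sqr_sqrtr// addr_ge0 ?sqr_ge0. Qed.

Lemma cRe_le z : `|cRe z| <= cmod z.
Proof.
rewrite -(ler_pXn2r (ltn0Sn 1)) ?nnegrE ?cmod_ge0// cmod_sqr real_normK ?num_real//.
by rewrite lerDl sqr_ge0.
Qed.

Lemma cIm_le z : `|cIm z| <= cmod z.
Proof.
rewrite -(ler_pXn2r (ltn0Sn 1)) ?nnegrE ?cmod_ge0// cmod_sqr real_normK ?num_real//.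
by rewrite lerDr sqr_ge0.
Qed.

Lemma cmod_le z : cmod z <= `|cRe z| + `|cIm z|.
Proof.
rewrite -(ler_pXn2r (ltn0Sn 1)) ?nnegrE ?cmod_ge0 ?addr_ge0// cmod_sqr.
rewrite sqrrD !real_normK ?num_real// lerD2r lerDl.
by rewrite mulrn_wge0// mulr_ge0.
Qed.

Lemma cmod_eq0 z : (cmod z == 0) = (z == 0).
Proof. by rewrite -(inj_eq (@complexI R)) cmodE normr_eq0. Qed.

Lemma cReD x y : cRe (x + y) = cRe x + cRe y. Proof. by case: x; case: y. Qed.
Lemma cImD x y : cIm (x + y) = cIm x + cIm y. Proof. by case: x; case: y. Qed.
Lemma cReN x : cRe (- x) = - cRe x. Proof. by case: x. Qed.
Lemma cImN x : cIm (- x) = - cIm x. Proof. by case: x. Qed.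
Lemma cReM x y : cRe (x * y) = cRe x * cRe y - cIm x * cIm y.
Proof. by case: x; case: y. Qed.
Lemma cImM x y : cIm (x * y) = cRe x * cIm y + cIm x * cRe y.
Proof. by case: x; case: y. Qed.
Lemma cReJ x : cRe x^* = cRe x. Proof. by case: x. Qed.
Lemma cImJ x : cIm x^* = - cIm x. Proof. by case: x. Qed.
Lemma cReV x : cRe x^-1 = cRe x / cmod x ^+ 2.
Proof. by rewrite cmod_sqr; case: x. Qed.
Lemma cImV x : cIm x^-1 = - cIm x / cmod x ^+ 2.
Proof. by rewrite cmod_sqr; case: x => x y; rewrite mulNr. Qed.

Lemma conjcM x y : (x * y)^*%C = x^*%C * y^*%C. Proof. exact: rmorphM. Qed.
Lemma conjcD x y : (x + y)^*%C = x^*%C + y^*%C. Proof. exact: rmorphD. Qed.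
Lemma conjcN x : (- x)^*%C = - x^*%C. Proof. exact: rmorphN. Qed.

Lemma eqcP x y : cRe x = cRe y -> cIm x = cIm y -> x = y.
Proof. by case: x; case: y => ? ? ? ?; rewrite /cRe /cIm/= => -> ->. Qed.

(** A quadratic remainder makes the difference quotient differ from [l] by at most [C * cmod h];
    this is how all derivatives of integrals are computed below. *)
Lemma quadratic_derivable (f : R[i] -> R[i]) z l (C d : R) : 0 < d ->
  (forall h, cmod h < d -> cmod (f (z + h) - f z - h * l) <= C * cmod h ^+ 2) ->
  derivable (f : R[i]^o -> R[i]^o) z 1.
Proof.
move=> d0 hf; apply/cvg_ex; exists l; apply/cvgrPdist_lt => e e0.
(* In the partial order of [R[i]], being positive forces [e] to be real. *)
have eE : e = (cRe e)%:C.
  by apply/eqcP => //; have /ger0_Im := ltW e0.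
have e0' : 0 < cRe e by rewrite -ltcR -eE.
have C1 : 0 < `|C| + 1 by rewrite ltr_wpDl.
near=> h.
have h0 : h != 0 by near: h; exact: nbhs_dnbhs_neq.
have hd : cmod h < d.
  by rewrite ltc_cmod; near: h; apply: dnbhs0_lt; rewrite ltcR.
have he : cmod h < cRe e / (`|C| + 1).
  by rewrite ltc_cmod; near: h; apply: dnbhs0_lt; rewrite ltcR divr_gt0.
rewrite eE -ltc_cmod /= -cmodN.
have cm0 : 0 < cmod h by rewrite lt0r cmod_eq0 h0 cmod_ge0.
have -> : - (l - h^-1 *: (f (h *: 1 + z) - f z)) = h^-1 * (f (z + h) - f z - h * l).
  by rewrite /GRing.scale/= mulr1 (addrC h z); field.
rewrite cmodM cmodV; apply: le_lt_trans (_ : (cmod h)^-1 * (C * cmod h ^+ 2) < _).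
  by rewrite ler_wpM2l ?invr_ge0 ?cmod_ge0// hf.
rewrite expr2 mulrCA mulKf ?gt_eqF//.
apply: le_lt_trans (_ : (`|C| + 1) * cmod h < _).
  by rewrite ler_wpM2r ?cmod_ge0// (le_trans (ler_norm _))// lerDl.
by rewrite mulrC -ltr_pdivlMr.
Unshelve. all: by end_near. Qed.

Lemma quadratic_derive1 (g : R -> R) (x0 l C d : R) : 0 < d ->
  (forall s, `|s| < d -> `|g (x0 + s) - g x0 - s * l| <= C * s ^+ 2) ->
  derive1 g x0 = l.
Proof.
move=> d0 hg; apply/cvg_lim => //; apply/cvgrPdist_lt => e e0.
have C1 : 0 < `|C| + 1 by rewrite ltr_wpDl.
near=> h.
have h0 : h != 0 by near: h; exact: nbhs_dnbhs_neq.
have hd : `|h| < d by near: h; apply: dnbhs0_lt.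
have he : `|h| < e / (`|C| + 1) by near: h; apply: dnbhs0_lt; rewrite divr_gt0.
have cm0 : 0 < `|h| by rewrite normr_gt0.
rewrite /= -normrN.
have -> : - (l - h^-1 *: (g (h + x0) - g x0)) = h^-1 * (g (x0 + h) - g x0 - h * l).
  by rewrite /GRing.scale/= (addrC h x0); field.
rewrite normrM normfV; apply: le_lt_trans (_ : `|h|^-1 * (C * h ^+ 2) < _).
  by rewrite ler_wpM2l ?invr_ge0 ?normr_ge0// hg.
rewrite -[h ^+ 2]real_normK ?num_real// expr2 mulrCA mulKf ?gt_eqF//.
apply: le_lt_trans (_ : (`|C| + 1) * `|h| < _).
  by rewrite ler_wpM2r// (le_trans (ler_norm _))// lerDl.
by rewrite mulrC -ltr_pdivlMr.
Unshelve. all: by end_near. Qed.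

End cmod_theory.

Section complex_integral.
Variable R : realType.
Implicit Types (G H : R -> R[i]) (c h z : R[i]) (t : R).
Local Notation mu := (@lebesgue_measure R).

Definition cbounded_measurable G : Prop :=
  bounded_measurable 0 (2 * pi) (fun t => cRe (G t)) /\
  bounded_measurable 0 (2 * pi) (fun t => cIm (G t)).

Definition cint G : R[i] :=
  (\int[mu]_(t in @I2pi R) cRe (G t))%R +i* (\int[mu]_(t in @I2pi R) cIm (G t))%R.

Lemma cbounded_measurableD G H : cbounded_measurable G -> cbounded_measurable H ->
  cbounded_measurable (fun t => G t + H t).
Proof.
move=> [G1 G2] [H1 H2]; split.
  by under eq_fun do rewrite cReD; exact: bounded_measurableD.
by under eq_fun do rewrite cImD; exact: bounded_measurableD.
Qed.

Lemma cbounded_measurableN G : cbounded_measurable G -> cbounded_measurable (fun t => - G t).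
Proof.
move=> [G1 G2]; split.
  by under eq_fun do rewrite cReN; exact: bounded_measurableN.
by under eq_fun do rewrite cImN; exact: bounded_measurableN.
Qed.

Lemma cbounded_measurableM G H : cbounded_measurable G -> cbounded_measurable H ->
  cbounded_measurable (fun t => G t * H t).
Proof.
move=> [G1 G2] [H1 H2]; split.
  under eq_fun do rewrite cReM.
  by apply: bounded_measurableB; exact: bounded_measurableM.
under eq_fun do rewrite cImM.
by apply: bounded_measurableD; exact: bounded_measurableM.
Qed.

Lemma cbounded_measurable_cst c : cbounded_measurable (fun=> c).
Proof. by split; exact: bounded_measurable_cst. Qed.

Lemma cbounded_measurableJ G : cbounded_measurable G -> cbounded_measurable (fun t => (G t)^*).
Proof.
move=> [G1 G2]; split; first by under eq_fun do rewrite cReJ.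
by under eq_fun do rewrite cImJ; exact: bounded_measurableN.
Qed.

Lemma cbounded_measurableX G (n : nat) : cbounded_measurable G ->
  cbounded_measurable (fun t => G t ^+ n).
Proof.
move=> bG; elim: n => [|n ih].
  by under eq_fun do rewrite expr0; exact: cbounded_measurable_cst.
by under eq_fun do rewrite exprS; exact: cbounded_measurableM.
Qed.

Lemma cbounded_measurable_bound G : cbounded_measurable G ->
  exists M, forall t, @I2pi R t -> cmod (G t) <= M.
Proof.
move=> [[_ [M GM]] [_ [N GN]]]; exists (M + N) => t It.
by apply: le_trans (cmod_le _ _) _; rewrite lerD ?GM ?GN.
Qed.

Let integ (g : R -> R) : bounded_measurable 0 (2 * pi) g ->
  mu.-integrable (@I2pi R) (EFin \o g).
Proof. exact: bounded_measurable_integrable. Qed.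

Let mI : measurable (@I2pi R).
Proof. exact: measurable_itv. Qed.

Lemma cintD G H : cbounded_measurable G -> cbounded_measurable H ->
  cint (fun t => G t + H t) = cint G + cint H.
Proof.
move=> [G1 G2] [H1 H2]; apply/eqcP; rewrite /cint ?cReD ?cImD /cRe /cIm/=.
  by rewrite -RintegralD//; [apply: eq_Rintegral => t _; exact: cReD|exact: integ|exact: integ].
by rewrite -RintegralD//; [apply: eq_Rintegral => t _; exact: cImD|exact: integ|exact: integ].
Qed.

Lemma cintZ c G : cbounded_measurable G -> cint (fun t => c * G t) = c * cint G.
Proof.
move=> [G1 G2]; apply/eqcP; rewrite /cint ?cReM ?cImM /cRe /cIm/=.
  rewrite -!RintegralZl//; try exact: integ.
  rewrite -RintegralB//; last 2 first.
  - by apply: integ; apply: bounded_measurableM => //; exact: bounded_measurable_cst.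
  - by apply: integ; apply: bounded_measurableM => //; exact: bounded_measurable_cst.
  by apply: eq_Rintegral => t _; exact: cReM.
rewrite -!RintegralZl//; try exact: integ.
rewrite -RintegralD//; last 2 first.
- by apply: integ; apply: bounded_measurableM => //; exact: bounded_measurable_cst.
- by apply: integ; apply: bounded_measurableM => //; exact: bounded_measurable_cst.
by apply: eq_Rintegral => t _; exact: cImM.
Qed.

Lemma cintN G : cbounded_measurable G -> cint (fun t => - G t) = - cint G.
Proof.
by move=> bG; rewrite -mulN1r -cintZ//; congr cint; apply/funext => t; rewrite mulN1r.
Qed.

Lemma cintJ G : cbounded_measurable G -> cint (fun t => (G t)^*) = (cint G)^*.
Proof.
move=> [G1 G2]; apply/eqcP; rewrite /cint ?cReJ ?cImJ /cRe /cIm/=.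
  by apply: eq_Rintegral => t _; exact: cReJ.
rewrite -mulN1r -RintegralZl//; last exact: integ.
by apply: eq_Rintegral => t _; rewrite mulN1r; exact: cImJ.
Qed.

Lemma eq_cint G H : (forall t, @I2pi R t -> G t = H t) -> cint G = cint H.
Proof.
move=> GH; rewrite /cint; congr (_ +i* _); apply: eq_Rintegral => t /[1!inE] It; by rewrite GH.
Qed.

Lemma cint_taylor (A B C : R -> R[i]) h : cbounded_measurable A -> cbounded_measurable B ->
  cbounded_measurable C ->
  cint A - cint B - h * cint C = cint (fun t => A t - B t - h * C t).
Proof.
move=> bA bB bC; have bNB := cbounded_measurableN _ bB.
have bhC := cbounded_measurableM _ _ (cbounded_measurable_cst h) bC.
rewrite (cintD _ _ (cbounded_measurableD _ _ bA bNB) (cbounded_measurableN _ bhC)).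
by rewrite (cintD _ _ bA bNB) (cintN _ bB) (cintN _ bhC) (cintZ _ _ bC).
Qed.

(** A Poisson integral is harmonic and in general not analytic, so its first-order term has an
    antilinear part, given by [E]. *)
Lemma cint_taylorJ (A B C E : R -> R[i]) h : cbounded_measurable A -> cbounded_measurable B ->
  cbounded_measurable C -> cbounded_measurable E ->
  cint A - cint B - (h * cint C + (h * cint E)^*) =
  cint (fun t => A t - B t - (h * C t + (h * E t)^*)).
Proof.
move=> bA bB bC bE; have bNB := cbounded_measurableN _ bB.
have bhC := cbounded_measurableM _ _ (cbounded_measurable_cst h) bC.
have bhE := cbounded_measurableM _ _ (cbounded_measurable_cst h) bE.
have bhEJ := cbounded_measurableJ _ bhE.
have bS := cbounded_measurableD _ _ bhC bhEJ.
rewrite (cintD _ _ (cbounded_measurableD _ _ bA bNB) (cbounded_measurableN _ bS)).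
rewrite (cintD _ _ bA bNB) (cintN _ bB) (cintN _ bS) (cintD _ _ bhC bhEJ).
by rewrite (cintJ _ bhE) (cintZ _ _ bC) (cintZ _ _ bE).
Qed.

Lemma Rintegral_norm_le (g : R -> R) (M : R) : bounded_measurable 0 (2 * pi) g ->
  (forall t, @I2pi R t -> `|g t| <= M) -> `|(\int[mu]_(t in @I2pi R) g t)%R| <= M * (2 * pi).
Proof.
move=> bg gM; have h : `|(\int[mu]_(t in @I2pi R) g t)%R| <= (\int[mu]_(t in @I2pi R) `|g t|)%R.
  by apply: le_normr_Rintegral => //; exact: integ.
apply: le_trans h _.
apply: (@le_trans _ _ (\int[mu]_(t in @I2pi R) (cst M t))%R).
  apply: le_Rintegral => //.
  - by apply: integ; case: bg => mg [N gN]; split; [exact: measurableT_comp|exists N => t It; rewrite normr_id gN].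
  - by apply: integ; exact: bounded_measurable_cst.
rewrite Rintegral_cst//= lebesgue_measure_itv/= lte_fin.
by rewrite mulr_gt0 ?pi_gt0//= subr0.
Qed.

(** The constant is twice the length of the interval because the real and imaginary parts are
    bounded separately. It only enters remainder terms and local bounds, never the final
    estimates. *)
Lemma cint_bound G M : cbounded_measurable G -> (forall t, @I2pi R t -> cmod (G t) <= M) ->
  cmod (cint G) <= 4 * pi * M.
Proof.
move=> [G1 G2] GM; apply: le_trans (cmod_le _ _) _.
have -> : 4 * pi * M = M * (2 * pi) + M * (2 * pi) :> R by ring.
apply: lerD; apply: Rintegral_norm_le => // t It.
  exact: le_trans (cRe_le _ _) (GM _ It).
exact: le_trans (cIm_le _ _) (GM _ It).
Qed.

Definition ccontinuous G : Prop :=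
  continuous (fun t => cRe (G t)) /\ continuous (fun t => cIm (G t)).

Lemma ccontinuous_bounded_measurable G : ccontinuous G -> cbounded_measurable G.
Proof. by move=> [G1 G2]; split; exact: continuous_bounded_measurable. Qed.

Lemma ccontinuous_cst c : ccontinuous (fun=> c).
Proof. by split=> t; exact: cvg_cst. Qed.

Lemma ccontinuousD G H : ccontinuous G -> ccontinuous H -> ccontinuous (fun t => G t + H t).
Proof.
move=> [G1 G2] [H1 H2]; split => t.
  by under eq_fun do rewrite cReD; apply: cvgD; [exact: G1|exact: H1].
by under eq_fun do rewrite cImD; apply: cvgD; [exact: G2|exact: H2].
Qed.

Lemma ccontinuousM G H : ccontinuous G -> ccontinuous H -> ccontinuous (fun t => G t * H t).
Proof.
move=> [G1 G2] [H1 H2]; split => t.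
  under eq_fun do rewrite cReM.
  by apply: cvgB; apply: cvgM; [exact: G1|exact: H1|exact: G2|exact: H2].
under eq_fun do rewrite cImM.
by apply: cvgD; apply: cvgM; [exact: G1|exact: H2|exact: G2|exact: H1].
Qed.

Lemma ccontinuousJ G : ccontinuous G -> ccontinuous (fun t => (G t)^*).
Proof.
move=> [G1 G2]; split => t; first by under eq_fun do rewrite cReJ; exact: G1.
by under eq_fun do rewrite cImJ; apply: cvgN; exact: G2.
Qed.

Lemma ccontinuousV G : (forall t, G t != 0) -> ccontinuous G -> ccontinuous (fun t => (G t)^-1).
Proof.
move=> G0 [G1 G2].
have c t : (cRe (G s) ^+ 2 + cIm (G s) ^+ 2)^-1 @[s --> t] --> (cRe (G t) ^+ 2 + cIm (G t) ^+ 2)^-1.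
  apply: cvgV; first by rewrite -cmod_sqr expf_neq0// cmod_eq0.
  by apply: cvgD; rewrite expr2; [apply: cvgM; exact: G1|apply: cvgM; exact: G2].
split => t.
  under eq_fun do rewrite cReV cmod_sqr.
  by apply: cvgM; [exact: G1|exact: c].
under eq_fun do rewrite cImV cmod_sqr.
by apply: cvgM; [apply: cvgN; exact: G2|exact: c].
Qed.

Lemma ccontinuous_expi : ccontinuous (@expi R).
Proof.
split => t; rewrite /expi /polar /cRe /cIm/=; apply: cvgM; try exact: cvg_cst.
  exact: continuous_cos.
exact: continuous_sin.
Qed.

Lemma cmod_polar (r t : R) : cmod (polar r t) = `|r|.
Proof.
rewrite /cmod /polar /cRe /cIm/= !exprMn -mulrDr cos2Dsin2 mulr1.
by rewrite sqrtr_sqr.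
Qed.

Lemma cmod_expi t : cmod (expi t) = 1.
Proof. by rewrite cmod_polar normr1. Qed.

End complex_integral.

(** Structural search: a function already known to be bounded and measurable is closed by
    hypothesis, compound expressions are split, and constants come last. *)
Ltac cbm := match goal with
  | H : cbounded_measurable _ ?G |- cbounded_measurable _ ?G => exact H
  | H : cbounded_measurable _ ?G |- cbounded_measurable _ (fun t => ?G t) => exact H
  | |- cbounded_measurable ?R (fun t => @?G t * @?H t) =>
    apply (cbounded_measurableM R G H); cbv beta; cbm
  | |- cbounded_measurable ?R (fun t => @?G t + @?H t) =>
    apply (cbounded_measurableD R G H); cbv beta; cbm
  | |- cbounded_measurable ?R (fun t => - (@?G t)) =>
    apply (cbounded_measurableN R G); cbv beta; cbm
  | |- cbounded_measurable ?R (fun t => (@?G t) ^+ ?n) =>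
    apply (cbounded_measurableX R G n); cbv beta; cbm
  | |- cbounded_measurable ?R (fun t => conjc (@?G t)) =>
    apply (cbounded_measurableJ R G); cbv beta; cbm
  | |- cbounded_measurable ?R (fun t => ?c) =>
    apply (cbounded_measurable_cst R c)
  | _ => idtac
  end.

(** * The Cauchy kernel and its Taylor expansions *)

Section cauchy_kernel.
Variable R : realType.
Implicit Types (f g w : R -> R[i]) (z h e : R[i]) (t : R).

Definition cauchy_kernel z t : R[i] := (1 - z * (expi t)^*%C)^-1.

Local Notation u := cauchy_kernel.

(** The factor of [g t] is the [z]-derivative of the Cauchy kernel [u z t], so this is 2 pi times
    the derivative of the Cauchy integral of [g]. *)
Definition cauchy2 g z : R[i] := cint R (fun t => g t * ((expi t)^*%C * u z t ^+ 2)).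

Definition poisson_sum g z : R[i] := cint R (fun t => g t * (u z t + (u z t)^*%C - 1)).

Lemma cmod_den_ge z t : 1 - cmod z <= cmod (1 - z * (expi t)^*%C).
Proof.
have := cmodB R 1 (z * (expi t)^*%C).
by rewrite cmodM cmodJ cmod_expi mulr1 -[X in cmod X - _](_ : 1%:C = 1)// cmod_real normr1.
Qed.

Lemma den_neq0 z t : cmod z < 1 -> 1 - z * (expi t)^*%C != 0.
Proof.
move=> z1; rewrite -cmod_eq0 gt_eqF//; apply: lt_le_trans (cmod_den_ge z t).
by rewrite subr_gt0.
Qed.

Lemma cauchy_kernel_le z d t : 0 < d -> d <= 1 - cmod z -> cmod (u z t) <= d^-1.
Proof.
move=> d0 dz; have d1 := le_trans dz (cmod_den_ge z t).
by rewrite /u cmodV lef_pV2 ?posrE// (lt_le_trans d0).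
Qed.

Lemma cauchy_kernel_bm z : cmod z < 1 -> cbounded_measurable R (u z).
Proof.
move=> z1; apply: ccontinuous_bounded_measurable.
apply: (ccontinuousV _ (fun t => 1 - z * (expi t)^*%C)) => [t|]; first exact: den_neq0.
have -> : (fun t => 1 - z * (expi t)^*%C) = (fun t => 1 + (- z) * (expi t)^*%C).
  by apply/funext => t; rewrite mulNr.
apply: (ccontinuousD _ (fun=> 1) (fun t => - z * (expi t)^*%C)); first exact: ccontinuous_cst.
apply: (ccontinuousM _ (fun=> - z) (fun t => (expi t)^*%C)); first exact: ccontinuous_cst.
by apply: (ccontinuousJ _ (@expi R)); exact: ccontinuous_expi.
Qed.

Lemma expiJ_bm : cbounded_measurable R (fun t => (expi t)^*%C).
Proof.
by apply: ccontinuous_bounded_measurable; apply: (ccontinuousJ _ (@expi R)); exact: ccontinuous_expi.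
Qed.

(** The remainder is exact, with [h ^+ 2] as a factor; the other factors are bounded uniformly on
    the circle as long as [z] and [z + h] stay away from it. *)
Lemma kernel_taylor1 z h e : 1 - z * e != 0 -> 1 - (z + h) * e != 0 ->
  (1 - (z + h) * e)^-1 - (1 - z * e)^-1 - h * (e * (1 - z * e)^-1 ^+ 2) =
  h ^+ 2 * e ^+ 2 * (1 - z * e)^-1 ^+ 2 * (1 - (z + h) * e)^-1.
Proof. by move=> a b; field; rewrite a b. Qed.

Lemma kernel_taylor2 z h e : 1 - z * e != 0 -> 1 - (z + h) * e != 0 ->
  e * (1 - (z + h) * e)^-1 ^+ 2 - e * (1 - z * e)^-1 ^+ 2
    - h * (2 * e ^+ 2 * (1 - z * e)^-1 ^+ 3) =
  h ^+ 2 * e ^+ 3 * (1 - z * e)^-1 ^+ 2 * (1 - (z + h) * e)^-1 *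
    ((1 - (z + h) * e)^-1 + 2 * (1 - z * e)^-1).
Proof. by move=> a b; field; rewrite a b. Qed.

Section at_point.
Variables (z : R[i]) (g : R -> R[i]).
Hypotheses (z1 : cmod z < 1) (bg : cbounded_measurable R g).

(** Half the distance to the circle: for [cmod h < d], both [z] and [z + h] are at distance at least
    [d] from it, so both kernels are at most [d^-1]. *)
Let d : R := (1 - cmod z) / 2.

Let d0 : 0 < d. Proof. by rewrite divr_gt0// subr_gt0. Qed.

Let zd : d <= 1 - cmod z.
Proof. by rewrite /d; have := z1; lra. Qed.

Let hd h : cmod h < d -> d <= 1 - cmod (z + h).
Proof.
rewrite {1}/d => hd; rewrite /d; have := cmodD _ z h; lra.
Qed.

Let lt1 h : cmod h < d -> cmod (z + h) < 1.
Proof. by move=> /hd; have := d0; lra. Qed.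

Let bE := expiJ_bm.

Let bK y : cmod y < 1 -> cbounded_measurable R (fun t => g t * ((expi t)^*%C * u y t ^+ 2)).
Proof. by move=> /cauchy_kernel_bm by_; have be := bE; have bg' := bg; cbm. Qed.

Lemma cauchy2_derivable : derivable (cauchy2 g : R[i]^o -> R[i]^o) z 1.
Proof.
have [M gM] := cbounded_measurable_bound _ _ bg.
have bz := cauchy_kernel_bm _ z1; have be := bE; have bg' := bg.
(* The [z]-derivative of [(expi t)^* * u ^+ 2] is [2 * (expi t)^* ^+ 2 * u ^+ 3], so the integral of
   [K'] is the candidate derivative. *)
pose K' t := g t * (2 * (expi t)^*%C ^+ 2 * u z t ^+ 3).
have bgK' : cbounded_measurable R K' by rewrite /K'; cbm.
apply: (@quadratic_derivable R _ _ (cint R K')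
   (4 * pi * (M * (d^-1 ^+ 3 * (d^-1 + 2 * d^-1)))) d d0) => h hlt.
have h1 := lt1 _ hlt; have bzh := cauchy_kernel_bm _ h1.
pose T t := g t * ((expi t)^*%C ^+ 3 * u z t ^+ 2 * u (z + h) t * (u (z + h) t + 2 * u z t)).
have bT : cbounded_measurable R T by rewrite /T; cbm.
rewrite /cauchy2 (cint_taylor _ _ _ _ h (bK _ h1) (bK _ z1) bgK').
have -> : cint R (fun t => g t * ((expi t)^*%C * u (z + h) t ^+ 2) -
      g t * ((expi t)^*%C * u z t ^+ 2) - h * K' t) = cint R (fun t => h ^+ 2 * T t).
  apply: eq_cint => t _.
  have := kernel_taylor2 z h (expi t)^*%C (den_neq0 _ _ z1) (den_neq0 _ _ h1).
  rewrite -/(u z t) -/(u (z + h) t) => E.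
  transitivity (g t * ((expi t)^*%C * u (z + h) t ^+ 2 - (expi t)^*%C * u z t ^+ 2 -
       h * (2 * (expi t)^*%C ^+ 2 * u z t ^+ 3))); first by rewrite /K'; ring.
  by rewrite E /T; ring.
rewrite (cintZ _ _ _ bT) cmodM cmodX mulrC ler_wpM2r ?exprn_ge0 ?cmod_ge0//.
apply: (cint_bound _ _ _ bT) => t It.
have uz : cmod (u z t) <= d^-1 by exact: cauchy_kernel_le.
have uh : cmod (u (z + h) t) <= d^-1 by apply: cauchy_kernel_le => //; exact: hd.
have -> : cmod (T t) = cmod (g t) * (cmod (u z t) ^+ 2 * cmod (u (z + h) t) *
    cmod (u (z + h) t + 2 * u z t)).
  by rewrite /T 4!cmodM !cmodX cmodJ cmod_expi expr1n mul1r.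
apply: ler_pM; rewrite ?mulr_ge0 ?exprn_ge0 ?cmod_ge0 ?gM//.
apply: ler_pM; rewrite ?mulr_ge0 ?exprn_ge0 ?cmod_ge0//.
  rewrite (exprSr d^-1 2); apply: ler_pM; rewrite ?exprn_ge0 ?cmod_ge0//.
  by rewrite lerXn2r ?nnegrE ?cmod_ge0// invr_ge0 ltW.
apply: le_trans (cmodD _ _ _) _; apply: lerD => //.
have c2 : cmod (2 : R[i]) = 2.
  by rewrite -[X in cmod X](rmorph_nat (@real_complex R)) cmod_real normr_nat.
by rewrite cmodM c2 ler_wpM2l.
Qed.

(** [u] contributes the linear term and its conjugate the antilinear one. Pulling the conjugation
    out of the integral also conjugates the data, hence [cauchy2] of the conjugate of [g]. *)
Lemma poisson_sum_taylor : exists C : R, forall h, cmod h < d ->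
  cmod (poisson_sum g (z + h) - poisson_sum g z
        - (h * cauchy2 g z + (h * cauchy2 (fun t => (g t)^*%C) z)^*%C)) <= C * cmod h ^+ 2.
Proof.
have [M gM] := cbounded_measurable_bound _ _ bg.
exists (4 * pi * (M * (d^-1 ^+ 3 + d^-1 ^+ 3))) => h hlt.
have h1 := lt1 _ hlt; have be := bE; have bg' := bg.
have bz := cauchy_kernel_bm _ z1; have bzh := cauchy_kernel_bm _ h1.
pose S t := (expi t)^*%C ^+ 2 * u z t ^+ 2 * u (z + h) t.
pose T t := g t * (h ^+ 2 * S t + (h ^+ 2 * S t)^*%C).
have bT : cbounded_measurable R T by rewrite /T /S; cbm.
have bP y : cmod y < 1 -> cbounded_measurable R (fun t => g t * (u y t + (u y t)^*%C - 1)).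
  by move=> /cauchy_kernel_bm by_; cbm.
have bgJ : cbounded_measurable R (fun t => (g t)^*%C * ((expi t)^*%C * u z t ^+ 2)) by cbm.
rewrite /poisson_sum /cauchy2 (cint_taylorJ _ _ _ _ _ h (bP _ h1) (bP _ z1) (bK _ z1) bgJ).
have -> : cint R (fun t => g t * (u (z + h) t + (u (z + h) t)^*%C - 1) -
      g t * (u z t + (u z t)^*%C - 1) -
      (h * (g t * ((expi t)^*%C * u z t ^+ 2)) +
       (h * ((g t)^*%C * ((expi t)^*%C * u z t ^+ 2)))^*%C)) = cint R T.
  apply: eq_cint => t _.
  have := kernel_taylor1 z h (expi t)^*%C (den_neq0 _ _ z1) (den_neq0 _ _ h1).
  rewrite -/(u z t) -/(u (z + h) t) => E.
  have {}E : h ^+ 2 * S t = u (z + h) t - u z t - h * ((expi t)^*%C * u z t ^+ 2).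
    by rewrite E /S; ring.
  by rewrite /T E !(expr2, conjcM, conjcD, conjcN) !conjcK; ring.
rewrite (_ : 4 * pi * _ * _ = 4 * pi * (M * ((d^-1 ^+ 3 + d^-1 ^+ 3) * cmod h ^+ 2))); last by ring.
apply: (cint_bound _ _ _ bT) => t It.
rewrite /T cmodM; apply: ler_pM; rewrite ?cmod_ge0 ?gM//.
have uz : cmod (u z t) <= d^-1 by exact: cauchy_kernel_le.
have uh : cmod (u (z + h) t) <= d^-1 by apply: cauchy_kernel_le => //; exact: hd.
have Sle : cmod (h ^+ 2 * S t) <= d^-1 ^+ 3 * cmod h ^+ 2.
  rewrite /S 3!cmodM !cmodX cmodJ cmod_expi expr1n mul1r mulrC ler_wpM2r ?exprn_ge0 ?cmod_ge0//.
  rewrite (exprSr d^-1 2); apply: ler_pM; rewrite ?exprn_ge0 ?cmod_ge0//.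
  by rewrite lerXn2r ?nnegrE ?cmod_ge0// invr_ge0 ltW.
by apply: le_trans (cmodD _ _ _) _; rewrite cmodJ mulrDl lerD.
Qed.

End at_point.
End cauchy_kernel.

(** * The Poisson kernel *)

Section poisson_kernel_theory.
Variable R : realType.
Implicit Types (r x y t : R) (z : R[i]).

(** The Poisson formula for [w] is given in polar coordinates, whereas [wx] and [wy] are Cartesian.
    The sign of the imaginary part selects the branch of the arccosine. *)
Lemma polar_surj z : exists theta, z = polar (cmod z) theta.
Proof.
have [z0|z0] := eqVneq (cmod z) 0.
  exists 0; rewrite z0 /polar !mul0r; apply/eqP; rewrite -[_ +i* _]/(0 : R[i]).
  by rewrite -cmod_eq0 z0.
have r0 : 0 < cmod z by rewrite lt0r z0 cmod_ge0.
set r := cmod z in z0 r0 *.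
have xr : -1 <= cRe z / r <= 1.
  rewrite -ler_norml normrM normfV (gtr0_norm r0) ler_pdivrMr// mul1r.
  exact: cRe_le.
have sE : Num.sqrt (1 - (cRe z / r) ^+ 2) = `|cIm z| / r.
  have -> : 1 - (cRe z / r) ^+ 2 = (cIm z / r) ^+ 2.
    have := cmod_sqr _ z; rewrite -/r !expr_div_n => E.
    rewrite -[X in X - _](divff (_ : r ^+ 2 != 0)) ?expf_neq0// E -mulrBl.
    by rewrite addrC addKr.
  by rewrite sqrtr_sqr normrM normfV (gtr0_norm r0).
have [i0|i0] := leP 0 (cIm z).
  exists (acos (cRe z / r)); apply/eqcP; rewrite /polar [RHS]/=.
    by rewrite acosK// mulrC divfK.
  by rewrite sin_acos// sE (ger0_norm i0) mulrC divfK.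
exists (- acos (cRe z / r)); apply/eqcP; rewrite /polar [RHS]/=.
  by rewrite cosN acosK// mulrC divfK.
by rewrite sinN sin_acos// sE (ltr0_norm i0) mulNr opprK mulrC divfK.
Qed.

Lemma polar_expiJ r t x : polar r x * (expi t)^*%C = polar r (x - t).
Proof.
apply/eqcP; rewrite /polar /expi /polar /cRe /cIm/= ?cosB ?sinB; ring.
Qed.

Definition poisson_den r x : R := 1 - 2 * r * cos x + r ^+ 2.

(** This is the squared modulus of 1 - r e^(ix), which is why it is positive inside the disk. *)
Lemma poisson_denE r x : poisson_den r x = (1 - r * cos x) ^+ 2 + (r * sin x) ^+ 2.
Proof.
rewrite /poisson_den [(r * sin x) ^+ 2]exprMn sin2cos2; ring.
Qed.

Lemma poisson_den_gt0 r x : 0 <= r < 1 -> 0 < poisson_den r x.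
Proof.
move=> /andP[r0 r1]; rewrite poisson_denE ltr_pwDl ?sqr_ge0// exprn_gt0// subr_gt0.
by rewrite (le_lt_trans _ r1)// -[leRHS]mulr1 ler_wpM2l// cos_le1.
Qed.

Lemma poisson_den_neq0 r x : 0 <= r < 1 -> poisson_den r x != 0.
Proof. by move=> r01; rewrite gt_eqF// poisson_den_gt0. Qed.

Lemma poisson_kernelE r x : poisson_kernel r x = (2 * pi)^-1 * ((1 - r ^+ 2) / poisson_den r x).
Proof. by []. Qed.

Lemma poisson_kernel_ge0 r x : 0 <= r < 1 -> 0 <= poisson_kernel r x.
Proof.
move=> r01; rewrite poisson_kernelE; apply: mulr_ge0.
  by rewrite invr_ge0 mulr_ge0 ?pi_ge0.
apply: divr_ge0; last exact/ltW/poisson_den_gt0.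
by rewrite subr_ge0; case/andP: r01 => r0 /ltW r1; rewrite exprn_ile1.
Qed.

Definition poisson_kernel' r x : R :=
  - ((2 * pi)^-1 * ((1 - r ^+ 2) * (2 * r * sin x) / poisson_den r x ^+ 2)).

Lemma is_derive_poisson_den r x : is_derive x 1 (poisson_den r) (2 * r * sin x).
Proof.
have -> : poisson_den r = (cst (1 + r ^+ 2) - (2 * r) \*: cos)%R.
  by apply/funext => y; rewrite /poisson_den /= !fctE/= /GRing.scale/=; ring.
apply: is_derive_eq; rewrite /GRing.scale/=; ring.
Qed.

Lemma is_derive_poisson_kernel r x theta : 0 <= r < 1 ->
  is_derive x 1 (fun t => poisson_kernel r (t - theta)) (poisson_kernel' r (x - theta)).
Proof.
move=> r01; have dn := poisson_den_neq0 r (x - theta) r01.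
have dD : is_derive x 1 (fun t => poisson_den r (t - theta)) (2 * r * sin (x - theta)).
  have h1 : is_derive x (1 : R) (fun t : R => t - theta) 1.
    by apply: is_derive_eq; rewrite subr0.
  have := @is_derive1_comp R (poisson_den r) (fun t => t - theta) x _ _ (is_derive_poisson_den r (x - theta)) h1.
  by rewrite mulr1.
have dV := @is_deriveV R (fun t => poisson_den r (t - theta)) x _ _ dn dD.
have -> : (fun t => poisson_kernel r (t - theta)) =
   ((2 * pi)^-1 * (1 - r ^+ 2)) \*: (fun t => (poisson_den r (t - theta))^-1).
  by apply/funext => t; rewrite poisson_kernelE /GRing.scale/= mulrA.
apply: is_derive_eq; rewrite /GRing.scale/= /poisson_kernel'; ring.
Qed.

Lemma continuous_poisson_den r : continuous (poisson_den r).
Proof.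
by move=> x; apply/differentiable_continuous/derivable1_diffP; case: (is_derive_poisson_den r x).
Qed.

Lemma continuous_poisson_kernel r : 0 <= r < 1 -> continuous (poisson_kernel r).
Proof.
move=> r01 x; apply: cvgM; first exact: cvg_cst.
apply: cvgM; first exact: cvg_cst.
by apply: cvgV; [exact: poisson_den_neq0|exact: continuous_poisson_den].
Qed.

Lemma continuous_poisson_kernel' r : 0 <= r < 1 -> continuous (poisson_kernel' r).
Proof.
move=> r01 x; apply: cvgN; apply: cvgM; first exact: cvg_cst.
apply: cvgM.
  by apply: cvgM; [exact: cvg_cst|apply: cvgM; [exact: cvg_cst|exact: continuous_sin]].
apply: cvgV; first by rewrite expf_neq0// poisson_den_neq0.
by rewrite expr2; apply: cvgM; exact: continuous_poisson_den.
Qed.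

Lemma continuous_translate (f : R -> R) theta : continuous f -> continuous (fun t => f (t - theta)).
Proof.
move=> cf x; apply: (@continuous_comp _ _ _ (fun t => t - theta) f); last exact: cf.
by apply: cvgB; [exact: cvg_id|exact: cvg_cst].
Qed.

Lemma cauchy_kernel_polar r x t : 0 <= r < 1 ->
  cauchy_kernel R (polar r x) t =
  ((1 - r * cos (t - x)) / poisson_den r (t - x)) +i* (- (r * sin (t - x)) / poisson_den r (t - x)).
Proof.
move=> r01; rewrite /cauchy_kernel polar_expiJ -(opprB t x); set y := t - x.
have E : cmod (1 - polar r (- y)) ^+ 2 = poisson_den r y.
  rewrite poisson_denE cmod_sqr /polar cosN sinN /cRe /cIm/=; ring.
apply/eqcP; rewrite ?cReV ?cImV E /polar cosN sinN /cRe /cIm/= ?(mulrN, opprK, sub0r)//.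
Qed.

Lemma poisson_kernel_cauchy r x t : 0 <= r < 1 ->
  (poisson_kernel r (t - x))%:C = ((2 * pi)^-1)%:C *
    (cauchy_kernel R (polar r x) t + (cauchy_kernel R (polar r x) t)^*%C - 1).
Proof.
move=> r01; rewrite cauchy_kernel_polar//; have dn := poisson_den_neq0 r (t - x) r01.
rewrite poisson_kernelE; apply/eqcP; rewrite /cRe /cIm/=.
  rewrite !mul0r subr0; congr (_ * _).
  have E : r ^+ 2 = poisson_den r (t - x) - 1 + 2 * r * cos (t - x) by rewrite /poisson_den; ring.
  rewrite E; move: dn; set D := poisson_den _ _ => dn; by field.
by rewrite !(mul0r, mulNr, addrN, opprK, subrr, subr0, mulr0, addr0, oppr0).
Qed.

(** Since q is z times the [z]-derivative of [u], the angular derivative of [u] is i q and that of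
    the Poisson kernel is i (q - conj q) / (2 pi). The kernel depends on t - x, so the latter is
    also minus [poisson_kernel']. *)
Lemma poisson_kernel'_cauchy r x t (q : R[i]) : 0 <= r < 1 ->
  q = polar r x * ((expi t)^*%C * cauchy_kernel R (polar r x) t ^+ 2) ->
  ((2 * pi)^-1)%:C * (q - q^*%C) = 'i * (poisson_kernel' r (t - x))%:C.
Proof.
move=> r01; rewrite cauchy_kernel_polar//; have dn := poisson_den_neq0 r (t - x) r01.
rewrite mulrA polar_expiJ -(opprB t x) /polar cosN sinN => ->.
rewrite /poisson_kernel'.
have E : poisson_den r (t - x) = 1 - 2 * r * cos (t - x) + r ^+ 2 by [].
have s2 : sin (t - x) ^+ 2 = 1 - cos (t - x) ^+ 2 by rewrite sin2cos2.
move: dn E s2; set D := poisson_den _ _; set c := cos _; set s := sin _ => dn E s2.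
apply/eqcP; rewrite expr2 ?(cReM, cImM, cReD, cImD, cReN, cImN, cReJ, cImJ) /cRe /cIm/=.
  by ring.
transitivity ((2 * pi)^-1 * - (2 * r * s) * (1 - r ^+ 2 * c ^+ 2 - r ^+ 2 * s ^+ 2) / D ^+ 2).
  by move: (2 * pi)^-1 => T; field.
by rewrite s2; ring.
Qed.

End poisson_kernel_theory.

(** * The Wirtinger derivatives of a Poisson integral *)

Section poisson_extension.
Variable R : realType.
Variables (F w : R[i] -> R[i]).
Local Notation f := (fun t => F (expi t)).
Local Notation mu := (@lebesgue_measure R).
Hypothesis bf : cbounded_measurable R f.
Hypothesis wP : forall r theta : R, 0 <= r < 1 -> w (polar r theta) = poisson_integral F r theta.

Let T : R[i] := ((2 * pi)^-1)%:C.

Lemma poisson_integralE z : cmod z < 1 -> w z = T * poisson_sum R f z.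
Proof.
move=> z1; have [x zE] := polar_surj R z; set r := cmod z in z1 zE.
have r01 : 0 <= r < 1 by rewrite z1 cmod_ge0.
have z1' : cmod (polar r x) < 1 by rewrite -zE.
have bu := cauchy_kernel_bm _ _ z1'; have bf' := bf.
rewrite zE wP// /poisson_sum -cintZ; last by cbm.
rewrite /poisson_integral /cint.
congr (_ +i* _); apply: eq_Rintegral => t _; rewrite mulrCA -poisson_kernel_cauchy//.
  by rewrite cReM /cRe /cIm/= mulr0 subr0 mulrC.
by rewrite cImM /cRe /cIm/= mulr0 add0r mulrC.
Qed.

(** The first-order term of [w] at [z] is h a + conj (h b). A real h gives w_x = a + conj b and an
    imaginary one w_y = i (a - conj b), whence w_z = a and w_zbar = conj b. *)
Lemma wz_wzbarE z : cmod z < 1 ->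
  wz w z = T * cauchy2 R f z /\ wzbar w z = (T * cauchy2 R (fun t => (f t)^*%C) z)^*%C.
Proof.
move=> z1; set a := T * cauchy2 R f z; set b := T * cauchy2 R _ z.
have [C hC] := poisson_sum_taylor R z f z1 bf.
set d := (1 - cmod z) / 2 in hC.
have d0 : 0 < d by rewrite divr_gt0// subr_gt0.
have TJ : T^*%C = T by rewrite /T conjc_real.
have taylor h : cmod h < d ->
    cmod (w (z + h) - w z - (h * a + (h * b)^*%C)) <= (cmod T * C) * cmod h ^+ 2.
  move=> hd; have zh : cmod (z + h) < 1.
    by have := cmodD _ z h; move: hd; rewrite /d; have := z1; lra.
  rewrite !poisson_integralE// -mulrA.
  rewrite (_ : _ - _ = T * (poisson_sum R f (z + h) - poisson_sum R f z
     - (h * cauchy2 R f z + (h * cauchy2 R (fun t => (f t)^*%C) z)^*%C))).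
    by rewrite cmodM ler_wpM2l ?cmod_ge0// hC.
  by rewrite /a /b !conjcM TJ; ring.
have zE : z = cRe z +i* cIm z by case: (z).
have dx (s : R) : `|s| < d -> cmod (w ((cRe z + s) +i* cIm z) - w (cRe z +i* cIm z) - s%:C * (a + b^*%C))
     <= (cmod T * C) * s ^+ 2.
  move=> sd; have := taylor s%:C; rewrite cmod_real real_normK ?num_real// => /(_ sd).
  rewrite -zE (_ : _ +i* _ = z + s%:C); last by rewrite [in RHS]zE; apply/eqcP; rewrite /cRe /cIm/= ?addr0.
  by rewrite conjcM conjc_real mulrDr.
have dy (s : R) : `|s| < d -> cmod (w (cRe z +i* (cIm z + s)) - w (cRe z +i* cIm z) - s%:C * ('i * (a - b^*%C)))
     <= (cmod T * C) * s ^+ 2.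
  move=> sd; have := taylor ('i * s%:C); rewrite cmodM cmod_i mul1r cmod_real real_normK ?num_real// => /(_ sd).
  rewrite -zE (_ : _ +i* _ = z + 'i * s%:C); last by rewrite [in RHS]zE; apply/eqcP; rewrite /cRe /cIm/=; ring.
  have iJ : 'i^*%C = - 'i :> R[i] by apply/eqcP; rewrite /cRe /cIm/= ?oppr0.
  rewrite !conjcM conjc_real iJ; congr (cmod _ <= _); ring.
have reC (s : R) (c : R[i]) : cRe (s%:C * c) = s * cRe c by rewrite cReM /cRe /cIm/= mul0r subr0.
have imC (s : R) (c : R[i]) : cIm (s%:C * c) = s * cIm c by rewrite cImM /cRe /cIm/= mul0r addr0.
have wxE : wx w z = a + b^*%C.
  rewrite /wx; apply/eqcP; rewrite [LHS]/=.
    apply: (@quadratic_derive1 R _ _ _ (cmod T * C) d d0) => s sd; apply: le_trans (dx _ sd).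
    by apply: le_trans (cRe_le _ _); rewrite !(cReD, cReN) reC.
  apply: (@quadratic_derive1 R _ _ _ (cmod T * C) d d0) => s sd; apply: le_trans (dx _ sd).
  by apply: le_trans (cIm_le _ _); rewrite !(cImD, cImN) imC.
have wyE : wy w z = 'i * (a - b^*%C).
  rewrite /wy; apply/eqcP; rewrite [LHS]/=.
    apply: (@quadratic_derive1 R _ _ _ (cmod T * C) d d0) => s sd; apply: le_trans (dy _ sd).
    by apply: le_trans (cRe_le _ _); rewrite !(cReD, cReN) reC.
  apply: (@quadratic_derive1 R _ _ _ (cmod T * C) d d0) => s sd; apply: le_trans (dy _ sd).
  by apply: le_trans (cIm_le _ _); rewrite !(cImD, cImN) imC.
have ii : 'i * 'i = -1 :> R[i] by apply/eqcP; rewrite /cRe /cIm/=; ring.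
rewrite /wz /wzbar wxE wyE !mulrA ii; split; by field.
Qed.

End poisson_extension.

(** * The angular derivative and the pointwise gradient bound *)

Section boundary_derivative.
Variable R : realType.
Local Notation mu := (@lebesgue_measure R).

Lemma abs_continuous_real_ac (a b : R) (g : R -> R[i]) (p : R[i] -> R) :
  (forall x y, `|p x - p y| <= cmod (x - y)) -> abs_continuous a b g ->
  real_ac R a b (fun t => p (g t)).
Proof.
move=> pl gac e /gac[d d0 h]; exists d => // s /andP[sa sp] sd.
pose P k := nth (0, 0) s k.
have subP k : (k < size s)%N -> subsegment R a b (P k) by move=> ks; exact: (all_nthP _ sa).
have E (G : R * R -> R) : \sum_(q <- s) G q = \sum_(k < size s) G (P k).
  by rewrite (big_nth (0, 0)) big_mkord.
have := h (size s) (fun k => (P k).1) (fun k => (P k).2).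
rewrite -(E (fun q => q.2 - q.1)) -(E (fun q => cmod (g q.2 - g q.1))) => {}h.
apply: le_trans (ltW (h _ _ sd)).
- by apply: ler_sum => q _; exact: pl.
- by move=> k /subP/and3P[? ? ?].
- move=> k l ks ls kl.
  have ov i j : (i < size s)%N -> (j < size s)%N -> (i < j)%N -> nonoverlapping R (P i) (P j).
    by move=> si sj; exact: (pairwiseP (0, 0) sp).
  have [kl'|lk|/kl//] := ltngtP k l.
    by have /orP := ov _ _ ks ls kl'.
  by have /orP[->|->] := ov _ _ ls ks lk; [right|left].
Qed.

(** The modulus [I] of the integral is the integral of the scalar product with the unit vector (A /
    I, B / I), and Cauchy-Schwarz bounds the integrand pointwise. *)
Lemma cmod_integral_le (D : set R) (a b : R -> R) : measurable D ->
  mu.-integrable D (EFin \o a) -> mu.-integrable D (EFin \o b) ->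
  mu.-integrable D (EFin \o (fun t => cmod (a t +i* b t))) ->
  cmod ((\int[mu]_(t in D) a t)%R +i* (\int[mu]_(t in D) b t)%R) <=
  (\int[mu]_(t in D) cmod (a t +i* b t))%R.
Proof.
move=> mD ia ib iab; set A := (\int[mu]_(t in D) a t)%R; set B := (\int[mu]_(t in D) b t)%R.
set I := cmod _; have I0 : 0 <= I := cmod_ge0 _ _.
have [->|In0] := eqVneq I 0; first by apply: Rintegral_ge0 => t _; exact: cmod_ge0.
have IE : I ^+ 2 = A ^+ 2 + B ^+ 2 by rewrite /I cmod_sqr.
have iZ (c : R) (g : R -> R) : mu.-integrable D (EFin \o g) -> mu.-integrable D (EFin \o (fun t => c * g t)).
  move=> ig; have -> : EFin \o (fun t => c * g t) = (fun t => c%:E * (EFin \o g) t)%E by apply/funext.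
  exact: integrableZl.
have -> : I = (\int[mu]_(t in D) (A / I * a t + B / I * b t))%R.
  rewrite RintegralD ?RintegralZl//; try exact: iZ.
  by rewrite -/A -/B -[LHS](mulfK In0) -expr2 IE; field.
apply: le_Rintegral => //.
  have -> : EFin \o (fun t => A / I * a t + B / I * b t) =
     ((EFin \o (fun t => (A / I * a t)%R)) \+ (EFin \o (fun t => (B / I * b t)%R)))%E by apply/funext.
  by apply: integrableD => //; exact: iZ.
move=> t _; apply: le_trans (ler_norm _) _.
rewrite -(ler_pXn2r (ltn0Sn 1)) ?nnegrE ?cmod_ge0// cmod_sqr/= real_normK ?num_real// /cRe /cIm/=.
rewrite -subr_ge0.
(* Lagrange's identity for a unit vector gives the defect in Cauchy-Schwarz as a square. *)
have -> : a t ^+ 2 + b t ^+ 2 - (A / I * a t + B / I * b t) ^+ 2 = (A / I * b t - B / I * a t) ^+ 2.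
  have u1 : (A / I) ^+ 2 + (B / I) ^+ 2 = 1.
    by rewrite !expr_div_n -mulrDl -IE divff// expf_neq0.
  rewrite -[X in X - _]mul1r -u1; ring.
exact: sqr_ge0.
Qed.

(** [F] lives on the circle, so its boundary function takes equal values at 0 and 2 pi; the kernel
    does too, and the boundary terms of the integration by parts cancel. *)
Lemma expi_2pi : expi (2 * pi) = expi 0 :> R[i].
Proof.
rewrite /expi /polar (_ : 2 * pi = 0 + pi + pi); last by ring.
by rewrite !cosDpi !sinDpi !opprK.
Qed.

Lemma poisson_kernel_periodic (r x : R) : poisson_kernel r (2 * pi - x) = poisson_kernel r (0 - x).
Proof.
rewrite /poisson_kernel (_ : 2 * pi - x = 0 - x + pi + pi); last by ring.
by rewrite !cosDpi opprK.
Qed.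

Section data.
Variables (F w : R[i] -> R[i]).
Hypothesis Fac : abs_continuous 0 (2 * pi) (fun t => F (expi t)).
Hypothesis mFre : measurable_fun (@I2pi R) (fun t => cRe (Fdot F t)).
Hypothesis mFim : measurable_fun (@I2pi R) (fun t => cIm (Fdot F t)).
Hypothesis wP : forall r theta : R, 0 <= r < 1 -> w (polar r theta) = poisson_integral F r theta.

Local Notation f := (fun t => F (expi t)).
Local Notation fre := (fun t => cRe (F (expi t))).
Local Notation fim := (fun t => cIm (F (expi t))).

Let pi2 : 0 < 2 * pi :> R.
Proof. by rewrite mulr_gt0 ?pi_gt0. Qed.

Let fre_ac : real_ac R 0 (2 * pi) fre.
Proof.
apply: abs_continuous_real_ac Fac => x y; rewrite -cReN -cReD; exact: cRe_le.
Qed.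

Let fim_ac : real_ac R 0 (2 * pi) fim.
Proof.
apply: abs_continuous_real_ac Fac => x y; rewrite -cImN -cImD; exact: cIm_le.
Qed.

Lemma boundary_bounded_measurable : cbounded_measurable R f.
Proof. by split; apply: real_ac_bounded_measurable => //; exact: ltW. Qed.

Let by_parts (g : R -> R) r theta : 0 <= r < 1 -> real_ac R 0 (2 * pi) g ->
  measurable_fun (@I2pi R) (derive1 g) -> g (2 * pi) = g 0 ->
  mu.-integrable (@I2pi R) (EFin \o derive1 g) /\
  (\int[mu]_(t in @I2pi R) (poisson_kernel' R r (t - theta) * g t))%R =
  - (\int[mu]_(t in @I2pi R) (poisson_kernel r (t - theta) * derive1 g t))%R.
Proof.
move=> r01 gac mg gper.
have [ig E] := @real_ac_integration_by_parts R 0 (2 * pi) g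
  (fun t => poisson_kernel r (t - theta)) (fun t => poisson_kernel' R r (t - theta))
  pi2 gac mg (fun x => is_derive_poisson_kernel R r x theta r01)
  (continuous_translate _ _ theta (continuous_poisson_kernel' R r r01)).
split=> //; apply/eqP; rewrite -addr_eq0; apply/eqP; rewrite E gper.
by rewrite poisson_kernel_periodic subrr.
Qed.

Lemma Fdot_integrable : mu.-integrable (@I2pi R) (EFin \o (fun t => cmod (Fdot F t))).
Proof.
(* The values r = 0 and theta = 0 are arbitrary: only the integrability half of [by_parts] is used
   here. *)
have r01 : (0 : R) <= (0 : R) < (1 : R) by rewrite lexx ltr01.
have gre : fre (2 * pi) = fre 0 by rewrite expi_2pi.
have gim : fim (2 * pi) = fim 0 by rewrite expi_2pi.
have [ire _] := by_parts _ _ 0 r01 fre_ac mFre gre.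
have [iim _] := by_parts _ _ 0 r01 fim_ac mFim gim.
apply: (@le_integrable _ _ _ mu _ (measurable_itv _) _
  (fun t => `|(derive1 fre t)%:E| + `|(derive1 fim t)%:E|)%E).
- have ms : measurable_fun setT (@Num.sqrt R).
    by apply: continuous_measurable_fun; exact: sqrt_continuous.
  have m2 : measurable_fun (@I2pi R) (fun t => cRe (Fdot F t) ^+ 2 + cIm (Fdot F t) ^+ 2).
    by apply: measurable_funD; apply: measurable_funX.
  by apply/measurable_EFinP; exact: (measurableT_comp ms m2).
- move=> t _ /=; rewrite lee_fin ger0_norm ?cmod_ge0//.
  by rewrite ger0_norm ?addr_ge0//; exact: cmod_le.
- by apply: integrableD; [exact: measurable_itv|exact: integrable_abse|exact: integrable_abse].
Qed.

Let Tc : R[i] := ((2 * pi)^-1)%:C.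

(** The left side is -i w_theta. Both Cauchy type integrals combine into one with kernel q - conj q,
    which is i times [poisson_kernel'] up to 2 pi; integrating by parts moves the derivative onto
    [F]. *)
Lemma angular_derivative r theta : 0 <= r < 1 ->
  polar r theta * wz w (polar r theta) - (polar r theta)^*%C * wzbar w (polar r theta) =
  - 'i * ((\int[mu]_(t in @I2pi R) (poisson_kernel r (t - theta) * cRe (Fdot F t)))%R +i*
          (\int[mu]_(t in @I2pi R) (poisson_kernel r (t - theta) * cIm (Fdot F t)))%R).
Proof.
move=> r01; set z := polar r theta; have z1 : cmod z < 1.
  by case/andP: r01 => r0 r1; rewrite cmod_polar ger0_norm.
have bf := boundary_bounded_measurable.
have [-> ->] := wz_wzbarE R F w bf wP z z1.
have bu := cauchy_kernel_bm _ _ z1; have be := expiJ_bm R.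
pose q t := z * ((expi t)^*%C * cauchy_kernel R z t ^+ 2).
have bq : cbounded_measurable R q by rewrite /q; cbm.
have E1 : z * (Tc * cauchy2 R f z) = Tc * cint R (fun t => f t * q t).
  have b : cbounded_measurable R (fun t => f t * ((expi t)^*%C * cauchy_kernel R z t ^+ 2)) by cbm.
  rewrite /cauchy2 mulrCA -(cintZ _ _ _ b); congr (_ * _).
  by apply: eq_cint => t _; rewrite /q; ring.
have E2 : z^*%C * (Tc * cauchy2 R (fun t => (f t)^*%C) z)^*%C = Tc * cint R (fun t => f t * (q t)^*%C).
  have b : cbounded_measurable R (fun t => (f t)^*%C * ((expi t)^*%C * cauchy_kernel R z t ^+ 2)) by cbm.
  have bz : cbounded_measurable R (fun t => z * ((f t)^*%C * ((expi t)^*%C * cauchy_kernel R z t ^+ 2))) by cbm.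
  rewrite -conjcM mulrCA /cauchy2 -(cintZ _ _ _ b) conjcM conjc_real -(cintJ _ _ bz); congr (_ * _).
  by apply: eq_cint => t _; rewrite /q !conjcM conjcK; ring.
have bfq : cbounded_measurable R (fun t => f t * q t) by cbm.
have bfqJ : cbounded_measurable R (fun t => - (f t * (q t)^*%C)) by cbm.
have bfqJ' : cbounded_measurable R (fun t => f t * (q t)^*%C) by cbm.
have bdiff : cbounded_measurable R (fun t => f t * q t + - (f t * (q t)^*%C)) by cbm.
rewrite E1 E2 -mulrBr -(cintN _ _ bfqJ') -(cintD _ _ _ bfq bfqJ) -(cintZ _ _ _ bdiff).
have -> : cint R (fun t => Tc * (f t * q t + - (f t * (q t)^*%C))) =
    cint R (fun t => 'i * ((poisson_kernel' R r (t - theta))%:C * f t)).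
  apply: eq_cint => t _.
  have := @poisson_kernel'_cauchy R r theta t (q t) r01 erefl.
  rewrite -/Tc => E; transitivity (f t * (Tc * (q t - (q t)^*%C))); first by ring.
  by rewrite E; ring.
have bpf : cbounded_measurable R (fun t => (poisson_kernel' R r (t - theta))%:C * f t).
  have bp : cbounded_measurable R (fun t => (poisson_kernel' R r (t - theta))%:C).
    apply: ccontinuous_bounded_measurable; split => /=.
      by apply: continuous_translate; exact: continuous_poisson_kernel'.
    by move=> t; exact: cvg_cst.
  by cbm.
rewrite (cintZ _ _ _ bpf) mulNr -mulrN; congr (_ * _).
have gre : fre (2 * pi) = fre 0 by rewrite expi_2pi.
have gim : fim (2 * pi) = fim 0 by rewrite expi_2pi.
have [_ Ere] := by_parts _ _ theta r01 fre_ac mFre gre.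
have [_ Eim] := by_parts _ _ theta r01 fim_ac mFim gim.
apply/eqcP; rewrite /cint.
  rewrite cReN; transitivity (\int[mu]_(t in @I2pi R) (poisson_kernel' R r (t - theta) * fre t))%R; last exact: Ere.
  by apply: eq_Rintegral => t _; rewrite cReM /cRe /cIm/= mul0r subr0.
rewrite cImN; transitivity (\int[mu]_(t in @I2pi R) (poisson_kernel' R r (t - theta) * fim t))%R; last exact: Eim.
by apply: eq_Rintegral => t _; rewrite cImM /cRe /cIm/= mul0r addr0.
Qed.

Lemma poisson_mul_integrable (g : R -> R) r theta : 0 <= r < 1 ->
  mu.-integrable (@I2pi R) (EFin \o g) ->
  mu.-integrable (@I2pi R) (EFin \o (fun t => poisson_kernel r (t - theta) * g t)).
Proof.
move=> r01 ig; apply: bounded_measurable_integrableM => //.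
by apply: continuous_bounded_measurable; apply: continuous_translate; exact: continuous_poisson_kernel.
Qed.

Lemma angular_derivative_le r theta : 0 <= r < 1 ->
  r * (cmod (wz w (polar r theta)) - cmod (wzbar w (polar r theta))) <=
  (\int[mu]_(t in @I2pi R) (poisson_kernel r (t - theta) * cmod (Fdot F t)))%R.
Proof.
move=> r01; have /andP[r0 _] := r01.
have E := angular_derivative r theta r01.
have := cmodB R (polar r theta * wz w (polar r theta)) ((polar r theta)^*%C * wzbar w (polar r theta)).
rewrite E !cmodM cmodJ cmod_polar (ger0_norm r0) -mulrBr cmodN cmod_i mul1r => h.
apply: le_trans h _.
have PE t : poisson_kernel r (t - theta) * cmod (Fdot F t) =
    cmod ((poisson_kernel r (t - theta) * cRe (Fdot F t)) +i* (poisson_kernel r (t - theta) * cIm (Fdot F t))).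
  rewrite -{1}(ger0_norm (poisson_kernel_ge0 R r (t - theta) r01)) -cmod_real -cmodM.
  by congr cmod; apply/eqcP; rewrite ?cReM ?cImM /cRe /cIm/= mul0r ?subr0 ?addr0.
have -> : (\int[mu]_(t in @I2pi R) (poisson_kernel r (t - theta) * cmod (Fdot F t)))%R =
   (\int[mu]_(t in @I2pi R) cmod ((poisson_kernel r (t - theta) * cRe (Fdot F t)) +i* (poisson_kernel r (t - theta) * cIm (Fdot F t))))%R.
  by apply: eq_Rintegral => t _; exact: PE.
have gre : fre (2 * pi) = fre 0 by rewrite expi_2pi.
have gim : fim (2 * pi) = fim 0 by rewrite expi_2pi.
have [ire _] := by_parts _ _ 0 r01 fre_ac mFre gre.
have [iim _] := by_parts _ _ 0 r01 fim_ac mFim gim.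
apply: cmod_integral_le; first exact: measurable_itv.
- exact: poisson_mul_integrable.
- exact: poisson_mul_integrable.
- under [X in EFin \o X]eq_fun do rewrite -PE.
  by apply: poisson_mul_integrable => //; exact: Fdot_integrable.
Qed.

Lemma quasiregular_le (K A B G r : R) : 1 <= K -> 0 <= A -> 0 <= B -> 0 <= G -> 0 <= r ->
  (A + B) ^+ 2 <= K * (A ^+ 2 - B ^+ 2) -> r * (A - B) <= G ->
  r * A <= K * G /\ r * B <= (K - 1) / 2 * G.
Proof.
move=> K1 A0 B0 G0 r0 qr rG.
have AB : A + B <= K * (A - B).
  (* The inequality is divided by [A + B]; if that is zero, both moduli vanish. *)
  have [S0|Sn0] := eqVneq (A + B) 0.
    by move/eqP: S0; rewrite paddr_eq0// => /andP[/eqP-> /eqP->]; rewrite subrr mulr0 addr0.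
  have S0 : 0 < A + B by rewrite lt0r Sn0 addr_ge0.
  by rewrite -(ler_pM2r S0) -expr2 (le_trans qr)// subr_sqr mulrA.
have rB : r * B <= (K - 1) / 2 * G.
  apply: le_trans (_ : (K - 1) / 2 * (r * (A - B)) <= _).
    by rewrite mulrCA ler_wpM2l//; move: AB; lra.
  by rewrite ler_wpM2l// divr_ge0// subr_ge0.
split => //.
have -> : r * A = r * (A - B) + r * B by ring.
apply: le_trans (lerD rG rB) _; rewrite -[X in X + _]mul1r -mulrDl ler_wpM2r//.
by move: K1; lra.
Qed.

Lemma gradient_le K r theta : 1 <= K -> qr_ineq w K -> 0 <= r < 1 ->
  let G := (\int[mu]_(t in @I2pi R) (poisson_kernel r (t - theta) * cmod (Fdot F t)))%R in
  r * cmod (wz w (polar r theta)) <= K * G /\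
  r * cmod (wzbar w (polar r theta)) <= (K - 1) / 2 * G.
Proof.
move=> K1 qr r01 G; have /andP[r0 r1] := r01; apply: quasiregular_le; rewrite ?cmod_ge0//.
- apply: Rintegral_ge0 => t _; rewrite mulr_ge0 ?cmod_ge0//.
  exact: poisson_kernel_ge0.
- by apply: qr; rewrite cmod_polar ger0_norm.
- exact: angular_derivative_le.
Qed.

End data.
End boundary_derivative.

(** * Integral means *)

Section poisson_means.
Variable R : realType.
Local Notation mu := (@lebesgue_measure R).
Implicit Types (r x t theta q : R).

(** The integral of a nonnegative function is a supremum over simple functions below it, hence
    monotone for arbitrary functions. This allows integral means of an arbitrary [f] to be
    bounded. *)
Lemma ge0_le_integral_nonmeasurable (D : set R) (f g : R -> \bar R) :
  (forall x, D x -> (0 <= f x)%E) -> (forall x, D x -> (f x <= g x)%E) ->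
  (\int[mu]_(x in D) f x <= \int[mu]_(x in D) g x)%E.
Proof.
move=> f0 fg; have fgD x : (0 <= (f \_ D) x <= (g \_ D) x)%E.
  rewrite !patchE; case: ifPn => [/set_mem Dx|_]; last by rewrite lexx.
  by rewrite f0//= fg.
rewrite integral_mkcond [leRHS]integral_mkcond.
rewrite ge0_integralTE; last by move=> x; have /andP[] := fgD x.
rewrite ge0_integralTE; last by move=> x; have /andP[] := fgD x; exact: le_trans.
apply: le_ereal_sup => _ [h hf <-]; exists h => // x; apply: le_trans (hf x) _.
by have /andP[] := fgD x.
Qed.

(* The arctangent is the argument of [1 - r e^(-ix)]; unlike the usual primitive in
   terms of [tan (x / 2)], this one is smooth on the whole line. *)
Definition poisson_primitive r x : R :=
  (2 * pi)^-1 * (x + 2 * atan (r * sin x / (1 - r * cos x))).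

Lemma is_derive_poisson_primitive r x : 0 <= r < 1 ->
  is_derive x 1 (poisson_primitive r) (poisson_kernel r x).
Proof.
move=> r01; have /andP[r0 r1] := r01.
have c0 y : 1 - r * cos y != 0.
  rewrite gt_eqF// subr_gt0 (le_lt_trans _ r1)// -[leRHS]mulr1 ler_wpM2l// cos_le1//.
have dn := poisson_den_neq0 R r x r01; have DE := poisson_denE R r x.
have d1 : is_derive x 1 (fun y => r * sin y) (r * cos x).
  by apply: is_derive_eq; rewrite /GRing.scale/=; ring.
have d2 : is_derive x 1 (fun y => 1 - r * cos y) (r * sin x).
  by apply: is_derive_eq; rewrite /GRing.scale/=; ring.
have d3 := @is_deriveV R (fun y => 1 - r * cos y) x _ _ (c0 x) d2.
have d4 : is_derive x 1 (fun y => r * sin y / (1 - r * cos y))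
    ((r * cos x * (1 - r * cos x) - (r * sin x) ^+ 2) / (1 - r * cos x) ^+ 2).
  apply: is_derive_eq; rewrite /GRing.scale/=; have := c0 x.
  by move: (cos x) (sin x) => c s cs; field.
have d5 := @is_derive1_comp R atan (fun y => r * sin y / (1 - r * cos y)) x _ _ (is_derive1_atan _) d4.
have d6 : is_derive x 1 (poisson_primitive r) ((2 * pi)^-1 * (1 + 2 *
   ((1 + (r * sin x / (1 - r * cos x)) ^+ 2)^-1 *
   ((r * cos x * (1 - r * cos x) - (r * sin x) ^+ 2) / (1 - r * cos x) ^+ 2)))).
  have -> : poisson_primitive r = (2 * pi)^-1 \*: (id + 2 \*: (atan \o (fun y => r * sin y / (1 - r * cos y)))).
    by apply/funext => y.
  by apply: is_derive_eq.
apply: (is_derive_eq d6); rewrite poisson_kernelE; congr (_ * _).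
have s2 : sin x ^+ 2 = 1 - cos x ^+ 2 by rewrite sin2cos2.
have {}DE : (1 + (r * sin x / (1 - r * cos x)) ^+ 2)^-1 = (1 - r * cos x) ^+ 2 / poisson_den R r x.
  rewrite DE; have := c0 x; have := dn; rewrite DE; move: (cos x) (sin x) => c s dcs cs.
  by field; rewrite cs dcs.
rewrite DE; have := c0 x; have : poisson_den R r x = 1 - 2 * r * cos x + r ^+ 2 by [].
move: dn s2; move: (poisson_den R r x) (cos x) (sin x) => d c s dn s2 dE cs.
transitivity ((d + 2 * (r * c * (1 - r * c) - r ^+ 2 * s ^+ 2)) / d).
  by field; rewrite cs dn.
by congr (_ / _); rewrite s2 dE; ring.
Qed.

(** The arctangent term of the primitive is 2 pi periodic, so only the linear term contributes, and
    it contributes 1. *)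
Lemma integral_poisson_kernel r theta : 0 <= r < 1 ->
  (\int[mu]_(t in @I2pi R) (poisson_kernel r (t - theta))%:E = 1)%E.
Proof.
move=> r01; have pi2 : 0 < 2 * pi :> R by rewrite mulr_gt0 ?pi_gt0.
have dP t : is_derive t 1 (fun t => poisson_primitive r (t - theta)) (poisson_kernel r (t - theta)).
  have h1 : is_derive t (1 : R) (fun t : R => t - theta) 1.
    by apply: is_derive_eq; rewrite subr0.
  have := @is_derive1_comp R (poisson_primitive r) (fun t => t - theta) t _ _
     (is_derive_poisson_primitive r (t - theta) r01) h1.
  by rewrite mulr1.
have cP : continuous (fun t => poisson_primitive r (t - theta)).
  by move=> t; apply/differentiable_continuous/derivable1_diffP; case: (dP t).
rewrite (@continuous_FTC2 _ _ (fun t => poisson_primitive r (t - theta)) _ _ pi2).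
- rewrite -EFinB /poisson_primitive (_ : 2 * pi - theta = 0 - theta + pi + pi); last by ring.
  rewrite !cosDpi !sinDpi !opprK; congr (_%:E).
  rewrite -mulrBr opprD addrACA subrr addr0.
  rewrite (_ : 0 - theta + pi + pi - (0 - theta) = 2 * pi); last by ring.
  by rewrite mulVf// gt_eqF.
- apply: continuous_subspaceT; apply: continuous_translate; exact: continuous_poisson_kernel.
- split; first by move=> t _; case: (dP t).
    by apply: cvg_at_right_filter; exact: cP.
  by apply: cvg_at_left_filter; exact: cP.
- by move=> t _; rewrite derive1E; case: (dP t).
Qed.

Lemma poisson_kernel_even r x : poisson_kernel r (- x) = poisson_kernel r x.
Proof. by rewrite /poisson_kernel cosN. Qed.

(** The convex function x^q lies above its tangent at [a]. This is Young's inequality for x and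
    a^(q-1) with exponents q and q / (q - 1), so q = 1 is treated apart. *)
Lemma powR_tangent q x a : 1 <= q -> 0 <= x -> 0 <= a ->
  q * a `^ (q - 1) * x <= x `^ q + (q - 1) * a `^ q.
Proof.
move=> q1 x0 a0; have [->|qn1] := eqVneq q 1.
  by rewrite subrr powRr0 mul0r addr0 powRr1// !mul1r.
have q1' : 1 < q by rewrite lt_neqAle eq_sym qn1.
have q0 : 0 < q by exact: lt_trans q1'.
have qm : 0 < q - 1 by rewrite subr_gt0.
have p0 : 0 < q / (q - 1) by rewrite divr_gt0.
have := @conjugate_powR R x (a `^ (q - 1)) q (q / (q - 1)) x0 (powR_ge0 _ _) q0 p0.
have e : q^-1 + (q / (q - 1))^-1 = 1 by field; rewrite !gt_eqF.
move=> /(_ e); rewrite -powRrM (_ : (q - 1) * (q / (q - 1)) = q); last by field; rewrite gt_eqF.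
rewrite -(ler_pM2l q0) => h; apply: le_trans (le_trans h _); first by rewrite mulrAC -mulrA.
rewrite le_eqVlt; apply/orP; left; apply/eqP.
by move: (x `^ q) (a `^ q) => u v; field; rewrite !gt_eqF.
Qed.

(** The tangent inequality is taken at the mean [a] itself and integrated against the kernel, of
    mass 1; the left side becomes q a^q, from which (q - 1) a^q is subtracted. *)
Lemma poisson_jensen (g : R -> R) r theta q : 0 <= r < 1 -> 1 <= q ->
  (forall t, 0 <= g t) -> mu.-integrable (@I2pi R) (EFin \o g) ->
  mu.-integrable (@I2pi R) (EFin \o (fun t => g t `^ q)) ->
  (\int[mu]_(t in @I2pi R) (poisson_kernel r (t - theta) * g t))%R `^ q <=
  (\int[mu]_(t in @I2pi R) (poisson_kernel r (t - theta) * g t `^ q))%R.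
Proof.
move=> r01 q1 g0 ig igq; set a := (\int[mu]_(t in @I2pi R) _)%R.
have mI : measurable (@I2pi R) by exact: measurable_itv.
have P0 t := poisson_kernel_ge0 R r (t - theta) r01.
have a0 : 0 <= a by apply: Rintegral_ge0 => t _; rewrite mulr_ge0.
have iP : mu.-integrable (@I2pi R) (EFin \o (fun t => poisson_kernel r (t - theta))).
  apply: bounded_measurable_integrable; apply: continuous_bounded_measurable.
  by apply: continuous_translate; exact: continuous_poisson_kernel.
have iPg := poisson_mul_integrable R g r theta r01 ig.
have iPgq := poisson_mul_integrable R _ r theta r01 igq.
have iZ (c : R) (h : R -> R) : mu.-integrable (@I2pi R) (EFin \o h) -> mu.-integrable (@I2pi R) (EFin \o (fun t => c * h t)).
  move=> ih; have -> : EFin \o (fun t => c * h t) = (fun t => c%:E * (EFin \o h) t)%E by apply/funext.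
  exact: integrableZl.
have : (\int[mu]_(t in @I2pi R) (q * a `^ (q - 1) * (poisson_kernel r (t - theta) * g t)))%R <=
  (\int[mu]_(t in @I2pi R) (poisson_kernel r (t - theta) * g t `^ q + (q - 1) * a `^ q * poisson_kernel r (t - theta)))%R.
  apply: le_Rintegral => //; first exact: iZ.
    have -> : EFin \o (fun t => poisson_kernel r (t - theta) * g t `^ q + (q - 1) * a `^ q * poisson_kernel r (t - theta)) =
      ((EFin \o (fun t => (poisson_kernel r (t - theta) * g t `^ q)%R)) \+
       (EFin \o (fun t => ((q - 1) * a `^ q * poisson_kernel r (t - theta))%R)))%E by apply/funext.
    by apply: integrableD => //; exact: iZ.
  move=> t _; rewrite mulrCA (mulrC ((q - 1) * _)) -mulrDr ler_wpM2l//.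
  exact: powR_tangent.
rewrite RintegralZl// -/a RintegralD//; last exact: iZ.
rewrite RintegralZl//.
have -> : (\int[mu]_(t in @I2pi R) poisson_kernel r (t - theta))%R = 1.
  by rewrite /Rintegral integral_poisson_kernel.
rewrite mulr1 -mulrA (mulrC _ a) mulr_powRB1//; last exact: lt_le_trans q1.
by move=> h; move: h; rewrite mulrBl mul1r; lra.
Qed.

(** After the exchange the inner integral runs over the angle, and evenness of the kernel turns it
    into its total mass, 1. *)
Lemma poisson_tonelli (g : R -> R) r : 0 <= r < 1 ->
  (forall t, 0 <= g t) -> measurable_fun (@I2pi R) g ->
  (\int[mu]_(theta in @I2pi R) \int[mu]_(t in @I2pi R) (poisson_kernel r (t - theta) * g t)%:E =
   \int[mu]_(t in @I2pi R) (g t)%:E)%E.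
Proof.
move=> r01 g0 mg.
have mI : measurable (@I2pi R) by exact: measurable_itv.
(* The square of integration is absorbed into the integrand, since Tonelli's theorem is applied on
   the whole plane. *)
pose k (p : R * R) : \bar R :=
  (\1_(@I2pi R) p.1 * (poisson_kernel r (p.2 - p.1) * (g \_ (@I2pi R)) p.2))%:E.
have gI0 t : 0 <= (g \_ (@I2pi R)) t by rewrite patchE; case: ifP.
have k0 p : (0 <= k p)%E.
  by rewrite lee_fin mulr_ge0 ?indicE// mulr_ge0// poisson_kernel_ge0.
have mgI : measurable_fun setT (g \_ (@I2pi R)).
  by apply/(measurable_restrictT _ _).1.
have mk : measurable_fun setT k.
  apply/measurable_EFinP; apply: measurable_funM.
    have m1 : measurable_fun setT (\1_(@I2pi R) : R -> R) by exact: measurable_indic.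
    exact: (measurableT_comp m1 measurable_fst).
  apply: measurable_funM; last exact: (measurableT_comp mgI measurable_snd).
  have mP : measurable_fun setT (@poisson_kernel R r).
    by apply: continuous_measurable_fun; exact: continuous_poisson_kernel.
  have mB : measurable_fun setT (fun p : R * R => p.2 - p.1).
    by apply: measurable_funB; [exact: measurable_snd|exact: measurable_fst].
  exact: (measurableT_comp mP mB).
have := @fubini_tonelli _ _ _ _ _ mu mu k mk k0.
have -> : (\int[mu]_x \int[mu]_y k (x, y) = \int[mu]_(theta in @I2pi R) \int[mu]_(t in @I2pi R) (poisson_kernel r (t - theta) * g t)%:E)%E.
  rewrite [RHS]integral_mkcond; apply: eq_integral => x _; rewrite patchE; case: ifPn => xI.
    rewrite [RHS]integral_mkcond; apply: eq_integral => y _.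
    rewrite /k/= indicE xI mul1r !patchE; case: ifP => // _.
    by rewrite mulr0.
  rewrite (_ : (fun y => k (x, y)) = cst 0%E) ?integral0//.
  by apply/funext => y; rewrite /k/= indicE (negbTE xI) mul0r.
move=> ->; rewrite [RHS]integral_mkcond; apply: eq_integral => y _.
have -> : (\int[mu]_x k (x, y) = ((g \_ (@I2pi R)) y)%:E * \int[mu]_(x in @I2pi R) (poisson_kernel r (x - y))%:E)%E.
  rewrite -ge0_integralZl_EFin//; last 2 first.
  - by move=> x _; rewrite lee_fin poisson_kernel_ge0.
  - apply/measurable_EFinP; apply: measurable_funTS; apply: continuous_measurable_fun.
    by apply: continuous_translate; exact: continuous_poisson_kernel.
  rewrite [RHS]integral_mkcond; apply: eq_integral => x _; rewrite patchE /k/= indicE.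
  case: ifP => _; last by rewrite mul0r.
  by rewrite mul1r -EFinM -(poisson_kernel_even r (x - y)) opprB mulrC.
rewrite integral_poisson_kernel// mule1 !patchE; by case: ifP.
Qed.

End poisson_means.

(** * From pointwise Poisson bounds to integral means and Hardy norms *)

Section means.
Variable R : realType.
Local Notation mu := (@lebesgue_measure R).
Implicit Types (r t theta q c : R).

Let mI : measurable (@I2pi R). Proof. exact: measurable_itv. Qed.

Let pi2 : 0 < 2 * pi :> R. Proof. by rewrite mulr_gt0 ?pi_gt0. Qed.

Lemma lebesgue_measure_I2pi : mu (@I2pi R) = (2 * pi)%:E.
Proof. by rewrite lebesgue_measure_itv/= lte_fin pi2 -EFinB subr0. Qed.

Lemma Lp_norm_ge0 (p : \bar R) (g : R -> R) : (1 <= p)%E -> (0 <= Lp_norm p g)%E.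
Proof.
case: p => [q _| _|//] /=; first exact: poweR_ge0.
apply: le_ereal_inf_tmp => y /= [N [mN N0 sN]].
rewrite leNgt; apply/negP => y0.
(* A negative essential bound of an absolute value would fail at every point of [I2pi], which has
   positive measure. *)
have sub : @I2pi R `<=` N.
  move=> t It; apply: sN => /= /(_ (mem_set It)); apply/negP; rewrite -ltNge.
  by apply: lt_le_trans y0 _; rewrite lee_fin.
have := le_measure mu (mem_set mI) (mem_set mN) sub.
by rewrite [leRHS]N0 [leLHS]lebesgue_measure_I2pi lee_fin leNgt pi2.
Qed.

Lemma Mp_bounded (p : \bar R) (f : R[i] -> R[i]) r c : (1 <= p)%E -> 0 <= c ->
  (forall theta, cmod (f (polar r theta)) <= c) -> (Mp p f r <= c%:E)%E.
Proof.
case: p => [q|_|//] /=; last first.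
  by move=> _ fc; apply: ge_ereal_sup => _ [theta _ <-]; rewrite lee_fin.
rewrite lee_fin => q1 c0 fc; have q0 : 0 < q by exact: lt_le_trans q1.
have h : (\int[mu]_(th in @I2pi R) (cmod (f (polar r th)) `^ q)%:E <= (c `^ q * (2 * pi))%:E)%E.
  apply: (@le_trans _ _ (\int[mu]_(th in @I2pi R) (cst (c `^ q)%:E th))%E).
    apply: ge0_le_integral_nonmeasurable => th _; first by rewrite lee_fin powR_ge0.
    by rewrite lee_fin ge0_ler_powR ?nnegrE ?cmod_ge0// ltW.
  by rewrite integral_cst// [X in (_ * X)%E]lebesgue_measure_I2pi EFinM.
have -> : c%:E = ((c `^ q)%:E `^ q^-1)%E.
  by rewrite poweR_EFin -powRrM divff ?gt_eqF// powRr1.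
have i0 : (0 <= \int[mu]_(th in @I2pi R) (cmod (f (polar r th)) `^ q)%:E)%E.
  by apply: integral_ge0 => th _; rewrite lee_fin powR_ge0.
have v0 : (0 <= ((2 * pi)^-1)%:E :> \bar R)%E by rewrite lee_fin invr_ge0 ltW.
apply: gt0_ler_poweR.
- by rewrite invr_ge0 ltW.
- by rewrite in_itv/= leey andbT mule_ge0.
- by rewrite in_itv/= leey andbT lee_fin powR_ge0.
- apply: le_trans (lee_wpmul2l v0 h) _.
  by rewrite -EFinM lee_fin mulrCA mulVf ?gt_eqF// mulr1.
Qed.

Lemma poweR_mean_le (I N : \bar R) (v c q : R) : (0 <= I)%E -> (0 <= N)%E -> 0 <= v -> 0 <= c ->
  0 < q -> (I <= (c `^ q)%:E * N)%E -> ((v%:E * I) `^ q^-1 <= c%:E * (v%:E * N) `^ q^-1)%E.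
Proof.
move=> I0 N0 v0 c0 q0 IN; have v0' : (0 <= v%:E)%E by rewrite lee_fin.
have cq0 : (0 <= (c `^ q)%:E)%E by rewrite lee_fin powR_ge0.
have -> : (c%:E * (v%:E * N) `^ q^-1 = ((c `^ q)%:E * (v%:E * N)) `^ q^-1)%E.
  rewrite [RHS]poweRM ?mule_ge0// poweR_EFin -powRrM divff ?gt_eqF//.
  by rewrite powRr1.
apply: gt0_ler_poweR.
- by rewrite invr_ge0 ltW.
- by rewrite in_itv/= leey andbT mule_ge0.
- by rewrite in_itv/= leey andbT !mule_ge0.
- by rewrite muleCA; exact: lee_wpmul2l.
Qed.

Variable g : R -> R.
Hypothesis g0 : forall t, 0 <= g t.
Hypothesis ig : mu.-integrable (@I2pi R) (EFin \o g).

Let mg : measurable_fun (@I2pi R) g.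
Proof. by have /integrableP[/measurable_EFinP] := ig. Qed.

(* Jensen's inequality for the probability density [t |-> P_r(t - theta)],
   integrated over [theta] with Tonelli. *)
Lemma poisson_power_mean (f : R -> R) r c q : 0 <= r < 1 -> 0 <= c -> 1 <= q ->
  mu.-integrable (@I2pi R) (EFin \o (fun t => g t `^ q)) -> (forall theta, 0 <= f theta) ->
  (forall theta, f theta <= c * (\int[mu]_(t in @I2pi R) (poisson_kernel r (t - theta) * g t))%R) ->
  (\int[mu]_(th in @I2pi R) (f th `^ q)%:E <=
   (c `^ q)%:E * \int[mu]_(t in @I2pi R) (g t `^ q)%:E)%E.
Proof.
move=> r01 c0 q1 igq f0 fle; have q0 : 0 < q by exact: lt_le_trans q1.
have mgq : measurable_fun (@I2pi R) (fun t => g t `^ q).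
  exact: (measurableT_comp (measurable_powR q) mg).
have gq0 t : 0 <= g t `^ q := powR_ge0 _ _.
have cgq0 t : 0 <= c `^ q * g t `^ q by rewrite mulr_ge0 ?powR_ge0.
have mcgq : measurable_fun (@I2pi R) (fun t => c `^ q * g t `^ q).
  by apply: measurable_funM => //; exact: measurable_cst.
have -> : ((c `^ q)%:E * \int[mu]_(t in @I2pi R) (g t `^ q)%:E = \int[mu]_(th in @I2pi R)
    \int[mu]_(t in @I2pi R) (poisson_kernel r (t - th) * (c `^ q * g t `^ q))%:E)%E.
  rewrite (poisson_tonelli R _ r r01 cgq0 mcgq).
  have -> : (fun t => (c `^ q * g t `^ q)%:E) = (fun t => (c `^ q)%:E * (g t `^ q)%:E)%E.
    by apply/funext => t; rewrite EFinM.
  rewrite ge0_integralZl_EFin ?powR_ge0//; last exact/measurable_EFinP.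
  by move=> t _; rewrite lee_fin.
apply: ge0_le_integral_nonmeasurable => th _; first by rewrite lee_fin powR_ge0.
have iPgq := poisson_mul_integrable R _ r th r01 igq.
have -> : (\int[mu]_(t in @I2pi R) (poisson_kernel r (t - th) * (c `^ q * g t `^ q))%:E =
    (c `^ q * (\int[mu]_(t in @I2pi R) (poisson_kernel r (t - th) * g t `^ q))%R)%:E)%E.
  rewrite EFinM /Rintegral fineK; last exact: integrable_fin_num.
  rewrite -ge0_integralZl_EFin ?powR_ge0//; last 2 first.
  - by move=> t _; rewrite lee_fin mulr_ge0 ?powR_ge0 ?poisson_kernel_ge0.
  - exact: measurable_int iPgq.
  by apply: eq_integral => t _; rewrite mulrCA EFinM.
have m0 : 0 <= (\int[mu]_(t in @I2pi R) (poisson_kernel r (t - th) * g t))%R.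
  by apply: Rintegral_ge0 => t _; rewrite mulr_ge0 ?poisson_kernel_ge0.
have := poisson_jensen R g r th q r01 q1 g0 ig igq.
move: (fle th) m0; move: (\int[mu]_(t in _) _)%R (\int[mu]_(t in _) _)%R => m' m fm m0 mm'.
rewrite lee_fin; apply: (@le_trans _ _ ((c * m) `^ q)).
  apply: ge0_ler_powR => //; first exact: ltW.
    by rewrite nnegrE.
  by rewrite nnegrE mulr_ge0.
by rewrite powRM// ler_wpM2l ?powR_ge0.
Qed.

(** For p infinite, a Poisson average of [g] is at most every essential bound of [g]. For finite p,
    [poisson_power_mean] applies with the constant [c / r] obtained by dividing the hypothesis by
    r. *)
Lemma Mp_poisson_le (p : \bar R) (f : R[i] -> R[i]) r c : (1 <= p)%E ->
  (Lp_norm p g < +oo)%E -> 0 < r < 1 -> 0 <= c ->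
  (forall theta, r * cmod (f (polar r theta)) <=
     c * (\int[mu]_(t in @I2pi R) (poisson_kernel r (t - theta) * g t))%R) ->
  (Mp p f r <= (c / r)%:E * Lp_norm p g)%E.
Proof.
move=> p1 Nfin /andP[r0 r1] c0 fle.
have r01 : 0 <= r < 1 by rewrite ltW.
have cr0 : 0 <= c / r by rewrite divr_ge0// ltW.
have {}fle theta : cmod (f (polar r theta)) <=
    c / r * (\int[mu]_(t in @I2pi R) (poisson_kernel r (t - theta) * g t))%R.
  by rewrite mulrAC ler_pdivlMr// mulrC.
case: p p1 Nfin => [q|_|//] /=; last first.
  set L := ereal_inf _ => Lfin.
  have L0 : (0 <= L)%E by apply: (Lp_norm_ge0 +oo%E g); rewrite leey.
  have Lf : L \is a fin_num by rewrite ge0_fin_numE.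
  apply: ge_ereal_sup => _ [theta _ <-].
  rewrite -(fineK Lf) -EFinM lee_fin; apply: le_trans (fle theta) _; rewrite ler_wpM2l//.
  (* To be below the infimum [L] is to be below each essential bound [y]; the value [-oo] is
     excluded by [0 <= L]. *)
  rewrite -lee_fin (fineK Lf); apply: le_ereal_inf_tmp => -[y| |] /= yae; last 2 first.
  - by rewrite leey.
  - have : (0 <= -oo :> \bar R)%E; last by [].
    by apply: le_trans L0 _; apply: ereal_inf_lbound.
  have iPg := poisson_mul_integrable R g r theta r01 ig.
  have iP : mu.-integrable (@I2pi R) (EFin \o (fun t => y * poisson_kernel r (t - theta))).
    apply: bounded_measurable_integrable; apply: bounded_measurableM; first exact: bounded_measurable_cst.
    by apply: continuous_bounded_measurable; apply: continuous_translate; exact: continuous_poisson_kernel.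
  have y0 : 0 <= y by rewrite -lee_fin; apply: le_trans L0 _; exact: ereal_inf_lbound.
  have fin_int : (\int[mu]_(t in @I2pi R) (poisson_kernel r (t - theta) * g t)%:E)%E \is a fin_num.
    exact: integrable_fin_num.
  rewrite /Rintegral fineK//.
  apply: (@le_trans _ _ (\int[mu]_(t in @I2pi R) (y * poisson_kernel r (t - theta))%:E)%E).
    apply: ae_ge0_le_integral => //.
    - by move=> t _; rewrite lee_fin mulr_ge0// poisson_kernel_ge0.
    - exact: measurable_int iPg.
    - by move=> t _; rewrite lee_fin mulr_ge0// poisson_kernel_ge0.
    - exact: measurable_int iP.
    - apply: (@filterS _ _ (ae_filter_ringOfSetsType mu) _ _ _ yae) => t yt It.
      have := yt (mem_set It); rewrite !lee_fin ger0_norm// => gy.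
      by rewrite (mulrC y) ler_wpM2l// poisson_kernel_ge0.
  under eq_integral do rewrite EFinM.
  rewrite ge0_integralZl_EFin//; last 2 first.
  - by move=> t _; rewrite lee_fin poisson_kernel_ge0.
  - apply/measurable_EFinP; apply: measurable_funTS; apply: continuous_measurable_fun.
    by apply: continuous_translate; exact: continuous_poisson_kernel.
  by rewrite integral_poisson_kernel// mule1.
rewrite lee_fin => q1 Nfin; have q0 : 0 < q by exact: lt_le_trans q1.
have qi0 : q^-1 != 0 by rewrite invr_eq0 gt_eqF.
have gq t : `|g t| `^ q = g t `^ q by rewrite ger0_norm.
have NE : (\int[mu]_(t in @I2pi R) (`|g t| `^ q)%:E = \int[mu]_(t in @I2pi R) (g t `^ q)%:E)%E.
  by apply: eq_integral => t _; rewrite gq.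
rewrite NE in Nfin *.
set N := (\int[mu]_(t in @I2pi R) (g t `^ q)%:E)%E in Nfin *.
have N0 : (0 <= N)%E by apply: integral_ge0 => t _; rewrite lee_fin powR_ge0.
(* A finite norm is a finite root of a positive multiple of [N], so [N] is finite; this makes the
   q-th power of [g] integrable, as Jensen's inequality requires. *)
have NN : (N < +oo)%E.
  have := lty_poweRy qi0 Nfin; move: N N0 {Nfin} => [x _ _|_|//]; first by rewrite ltry.
  by rewrite gt0_muley// lte_fin invr_gt0.
have mgq : measurable_fun (@I2pi R) (fun t => g t `^ q).
  exact: (measurableT_comp (measurable_powR q) mg).
have igq : mu.-integrable (@I2pi R) (EFin \o (fun t => g t `^ q)).
  apply/integrableP; split; first exact/measurable_EFinP.
  apply: le_lt_trans NN; apply: ge0_le_integral_nonmeasurable => t _; first exact: abse_ge0.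
  by rewrite /= lee_fin ger0_norm ?powR_ge0.
have v0 : 0 <= (2 * pi)^-1 :> R by rewrite invr_ge0 ltW.
have i0 : (0 <= \int[mu]_(th in @I2pi R) (cmod (f (polar r th)) `^ q)%:E)%E.
  by apply: integral_ge0 => th _; rewrite lee_fin powR_ge0.
have f0 theta : 0 <= cmod (f (polar r theta)) := cmod_ge0 _ _.
have h := poisson_power_mean _ r (c / r) q r01 cr0 q1 igq f0 fle.
exact: (poweR_mean_le _ _ _ _ _ i0 N0 v0 cr0 q0 h).
Qed.

(* When [Mp p f r] has no limit, [lim] returns the default value 0. *)
Lemma hardy_norm_le (p : \bar R) (f : R[i] -> R[i]) c (L : \bar R) : 0 <= c -> (0 <= L < +oo)%E ->
  (forall r, 0 < r < 1 -> (Mp p f r <= (c / r)%:E * L)%E) ->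
  (hardy_norm p f <= c%:E * L)%E.
Proof.
move=> c0 /andP[L0 Loo] fle; have Lf : L \is a fin_num by rewrite ge0_fin_numE.
rewrite /hardy_norm; have [cf|ncf] := pselect (cvg (Mp p f r @[r --> 1^'-])); last first.
  by rewrite (dvgP ncf) mule_ge0.
have cL : ((c / r)%:E * L)%E @[r --> (1 : R)^'-] --> (c%:E * L)%E.
  rewrite -(fineK Lf); under eq_fun do rewrite -EFinM; rewrite -EFinM.
  apply: cvg_EFin; first exact: nearW.
  apply: cvgM; last exact: cvg_cst.
  rewrite -[X in _ --> X](divr1 c); apply: cvgM; first exact: cvg_cst.
  by apply: cvg_at_left_filter; apply: cvgV; [exact: oner_neq0|exact: cvg_id].
apply: (lee_cvg_to cf cL); near=> r; apply: fle; apply/andP; split.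
  by near: r; apply: nbhs_left_gt; exact: ltr01.
by near: r; exact: nbhs_left_lt.
Unshelve. all: by end_near. Qed.

(** The bound [c / r * L] is unbounded near r = 0. Below 1/2 the pointwise bound [C] takes over, and
    from 1/2 on 1 / r is at most 2. *)
Lemma hardy_of_le (p : \bar R) (f : R[i] -> R[i]) c C (L : \bar R) : (1 <= p)%E -> 0 <= c ->
  (0 <= L < +oo)%E -> analytic_disk f ->
  (forall r theta, 0 < r < 2^-1 -> cmod (f (polar r theta)) <= C) ->
  (forall r, 0 < r < 1 -> (Mp p f r <= (c / r)%:E * L)%E) ->
  hardy p f.
Proof.
move=> p1 c0 /andP[L0 Loo] fan fC fle; have Lf : L \is a fin_num by rewrite ge0_fin_numE.
split=> //; exists (Num.max `|C| (2 * c * fine L)) => r /andP[r0 r1].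
have [r2|r2] := ltP r 2^-1.
  apply: (@le_trans _ _ `|C|%:E); last by rewrite lee_fin le_max lexx.
  apply: Mp_bounded => // theta; apply: le_trans (ler_norm _).
  by apply: fC; rewrite r0.
apply: le_trans (fle r _) _; first by rewrite r0.
rewrite -(fineK Lf) -EFinM lee_fin le_max; apply/orP; right => /=.
rewrite ler_wpM2r ?fine_ge0// mulrC ler_wpM2r//.
by rewrite -[leRHS]invrK lef_pV2 ?posrE ?invr_gt0.
Qed.

End means.

(** * Analyticity and local boundedness of the Cauchy type integrals *)

Section cauchy2_regularity.
Variable R : realType.
Implicit Types (g : R -> R[i]) (h : R[i] -> R[i]) (z c : R[i]).

Lemma cauchy2_analytic g h c : cbounded_measurable R g ->
  (forall z, cmod z < 1 -> h z = c * cauchy2 R g z) -> analytic_disk h.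
Proof.
move=> bg hE z z1.
have d0 : 0 < (1 - cmod z)%:C :> R[i] by rewrite ltcR subr_gt0.
(* [h] is known only inside the disk; the disk being open, the equality holds near [z] and
   differentiability transfers. *)
have E : \forall y \near (z : R[i]^o), c *: (cauchy2 R g y : R[i]^o) = h y.
  near=> y; rewrite hE//.
  have : `|z - y| < (1 - cmod z)%:C by near: y; exact: (nbhsx_ballx (z : R[i]^o) _ d0).
  rewrite -ltc_cmod -cmodN opprB => yz.
  have := cmodD _ (y - z) z; rewrite subrK; move: yz; lra.
apply: near_eq_derivable E _; apply: derivableZ.
exact: cauchy2_derivable.
Unshelve. all: by end_near. Qed.

Lemma cauchy2_bounded g : cbounded_measurable R g ->
  exists C : R, forall z, cmod z <= 2^-1 -> cmod (cauchy2 R g z) <= C.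
Proof.
move=> bg; have [M gM] := cbounded_measurable_bound _ _ bg.
exists (4 * pi * (M * 2 ^+ 2)) => z z2.
have z1 : cmod z < 1 by move: z2; lra.
have bu := cauchy_kernel_bm _ _ z1; have be := expiJ_bm R.
have b : cbounded_measurable R (fun t => g t * ((expi t)^*%C * cauchy_kernel R z t ^+ 2)) by cbm.
apply: (cint_bound _ _ _ b) => t It.
have u2 : cmod (cauchy_kernel R z t) <= 2.
  by rewrite -[leRHS]invrK; apply: cauchy_kernel_le; [rewrite invr_gt0|move: z2; lra].
rewrite cmodM cmodM cmodX cmodJ cmod_expi mul1r.
by apply: ler_pM; rewrite ?exprn_ge0 ?cmod_ge0 ?gM// lerXn2r ?nnegrE ?cmod_ge0.
Qed.

End cauchy2_regularity.

Theorem theorem1p3 (R : realType) (p : \bar R) (F : R[i] -> R[i])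
    (w : R[i] -> R[i]) (K : R) :
  (1 <= p)%E ->
  abs_continuous 0 (2 * pi) (fun t => F (expi t)) ->
  measurable_fun (@I2pi R) (fun t => cRe (Fdot F t)) ->
  measurable_fun (@I2pi R) (fun t => cIm (Fdot F t)) ->
  (Lp_norm p (fun t => cmod (Fdot F t)) < +oo)%E ->
  (forall r theta : R, 0 <= r < 1 -> w (polar r theta) = poisson_integral F r theta) ->
  outer_dilatation w K ->
  [/\ hardy p (wz w),
      hardy p (fun z => (wzbar w z)^*),
      (hardy_norm p (wz w) <= K%:E * Lp_norm p (fun t => cmod (Fdot F t)))%E
    & (hardy_norm p (fun z => (wzbar w z)^*)
         <= ((K - 1) / 2)%:E * Lp_norm p (fun t => cmod (Fdot F t)))%E].
Proof.
move=> p1 Fac mFre mFim Nfin wP [K1 qr _].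
have bf := boundary_bounded_measurable R F Fac.
have bfJ := cbounded_measurableJ _ _ bf.
have ig := Fdot_integrable R F Fac mFre mFim.
have g0 (t : R) : 0 <= cmod (Fdot F t) := cmod_ge0 _ _.
have N0 := Lp_norm_ge0 R p (fun t => cmod (Fdot F t)) p1.
have NL : (0 <= Lp_norm p (fun t => cmod (Fdot F t)) < +oo)%E by rewrite N0 Nfin.
have K0 : 0 <= K by exact: le_trans K1.
have K10 : 0 <= (K - 1) / 2 by rewrite divr_ge0 ?subr_ge0.
have wzE z : cmod z < 1 -> wz w z = ((2 * pi)^-1)%:C * cauchy2 R (fun t => F (expi t)) z.
  by move=> /(wz_wzbarE R F w bf wP)[].
have wzbarE z : cmod z < 1 ->
    (wzbar w z)^*%C = ((2 * pi)^-1)%:C * cauchy2 R (fun t => (F (expi t))^*%C) z.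
  by move=> /(wz_wzbarE R F w bf wP)[_ ->]; rewrite conjcK.
(* Both derivatives are multiples of a [cauchy2], so one argument bounds them on the radii below
   1/2, as [hardy_of_le] requires. *)
have small (h : R[i] -> R[i]) g : cbounded_measurable R g ->
    (forall z, cmod z < 1 -> h z = ((2 * pi)^-1)%:C * cauchy2 R g z) ->
    exists C, forall r theta : R, 0 < r < 2^-1 -> cmod (h (polar r theta)) <= C.
  move=> /cauchy2_bounded[C gC] hE; exists (cmod (((2 * pi)^-1)%:C : R[i]) * C) => r theta /andP[r0 r2].
  have cr : cmod (polar r theta) = r by rewrite cmod_polar gtr0_norm.
  rewrite hE ?cr; last by move: r2; lra.
  by rewrite cmodM ler_wpM2l ?cmod_ge0// gC// cr ltW.
have wzle r : 0 < r < 1 -> (Mp p (wz w) r <= (K / r)%:E * Lp_norm p (fun t => cmod (Fdot F t)))%E.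
  move=> r01; apply: Mp_poisson_le => // theta.
  have [] := gradient_le R F w Fac mFre mFim wP K r theta K1 qr _ => //.
  by case/andP: r01 => /ltW->.
have wzbarle r : 0 < r < 1 -> (Mp p (fun z => (wzbar w z)^*%C) r <=
    ((K - 1) / 2 / r)%:E * Lp_norm p (fun t => cmod (Fdot F t)))%E.
  move=> r01; apply: Mp_poisson_le => // theta; rewrite cmodJ.
  have [] := gradient_le R F w Fac mFre mFim wP K r theta K1 qr _ => //.
  by case/andP: r01 => /ltW->.
have [C1 wzC] := small _ _ bf wzE; have [C2 wzbarC] := small _ _ bfJ wzbarE.
split.
- exact: hardy_of_le K0 NL (cauchy2_analytic _ _ _ _ bf wzE) wzC wzle.
- exact: hardy_of_le K10 NL (cauchy2_analytic _ _ _ _ bfJ wzbarE) wzbarC wzbarle.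
- exact: hardy_norm_le.
- exact: hardy_norm_le.
Qed.
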